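(* Let $p\ge1$ be an integer, let $\mu\neq0$ be a fixed real frequency, $\lambda=\mu^2$, and let $0<h<1$. Consider the $C^{p-1}$ B-splines $\theta^j_p$ of degree $p$ on the uniform grid of size $h$ on the real line. Let $G_{p+1}$ be the $(p+1)$-point Gauss--Legendre rule and let $Q_p\neq G_{p+1}$ be a quadrature rule that integrates exactly every polynomial of degree at most $2p-2$, does not integrate the mass entries exactly, and is not already optimal ($Q_p\ne O_p$). Put $$\tau=\frac{\sum_{k=1}^p\left(\frac{k^{2p+2}}{(2p+2)!}\tilde A^{j+k}_{p,Q_p}+\frac{k^{2p}}{(2p)!}\tilde B^{j+k}_{p,Q_p}\right)}{\sum_{k=1}^p\frac{k^{2p}}{(2p)!}\left(\tilde B^{j+k}_{p,Q_p}-B^{j+k}_p\right)},$$ and let $\tilde\lambda^h_{p,O_p}$ be the approximate eigenvalue obtained with the blended rule $Q_\tau=\tau G_{p+1}+(1-\tau)Q_p$, associated with the Bloch wave of frequency $\mu$. Then, as $h\to0$, $$\tilde\lambda^h_{p,O_p}-\lambda=2(-1)^p\left(\sum_{k=1}^p\left(\frac{k^{2p+4}}{(2p+4)!}A^{j+k}_p+\frac{k^{2p+2}}{(2p+2)!}\left(\tau B^{j+k}_p+(1-\tau)\tilde B^{j+k}_{p,Q_p}\right)\right)\right)\mu^{2p+4}h^{2p+2}+\mathcal O(h^{2p+4}).$$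
   Context: Uniform knots $x_j=jh$, $j\in\mathbb Z$, $h>0$, on the real line. The B-splines are defined by $\theta^j_0=1$ on $[x_j,x_{j+1})$ and $0$ otherwise, and $$\theta^j_p(x)=\frac{x-x_j}{x_{j+p}-x_j}\theta^j_{p-1}(x)+\frac{x_{j+p+1}-x}{x_{j+p+1}-x_{j+1}}\theta^{j+1}_{p-1}(x).$$ Exact stiffness and mass entries: $A^{j+k}_p=h\int(\theta^j_p)'(\theta^{j+k}_p)'\,dx$ and $B^{j+k}_p=\frac1h\int\theta^j_p\theta^{j+k}_p\,dx$, independent of $h$ and $j$, symmetric in $k$, and zero for $|k|>p$. Quadrature: a rule $Q$ is given by real weights $\hat\varpi_l$ and nodes $\hat n_l\in[0,1]$ on the reference interval, $\int_0^1\hat f\approx\sum_l\hat\varpi_l\hat f(\hat n_l)$, and it is applied on every element $[x_i,x_{i+1}]$ through the affine map $\hat x\mapsto x_i+h\hat x$ (integrands being polynomials on each element). The resulting approximations of $\int(\theta^j_p)'(\theta^{j+k}_p)'$ times $h$, and of $\int\theta^j_p\theta^{j+k}_p$ divided by $h$, are denoted $\tilde A^{j+k}_{p,Q}$ and $\tilde B^{j+k}_{p,Q}$. The rule $\tau G_{p+1}+(1-\tau)Q_p$ means the corresponding affine combination of the two quadrature functionals. $G_{p+1}$ reproduces $A^{j+k}_p$, $B^{j+k}_p$ exactly, and $\tilde A^{j+k}_{p,Q_p}=A^{j+k}_p$. ''$Q_p\ne O_p$'' means that the entries of $Q_p$ do not already satisfy $\sum_{k=1}^p\left(\frac{k^{2m}}{(2m)!}A^{j+k}_p+\frac{k^{2m-2}}{(2m-2)!}\tilde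 B^{j+k}_{p,Q_p}\right)=0$ for all $m=2,\dots,p+1$. Approximate eigenvalue for a rule $Q$ integrating the stiffness exactly: testing the discrete eigenvalue equation with $\theta^j_p$ and inserting Bloch coefficients $U^l=e^{il\mu h}$, $i^2=-1$, gives $$\tilde\lambda^h=\frac1{h^2}\,\frac{A^j_p+2\sum_{k=1}^pA^{j+k}_p\cos(k\mu h)}{\tilde B^j_{p,Q}+2\sum_{k=1}^p\tilde B^{j+k}_{p,Q}\cos(k\mu h)};$$ the exact eigenvalue is $\lambda=\mu^2$, and $\tilde\lambda^h_{p,O_p}$ is this quantity for $Q=Q_\tau$. *)

(* Defs.v *)
From HB Require Import structures.
From mathcomp Require Import all_boot all_order all_algebra.
From mathcomp Require Import all_classical all_reals all_analysis.

Set Implicit Arguments.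
Unset Strict Implicit.
Unset Printing Implicit Defensive.
Import Order.TTheory GRing.Theory Num.Theory.
Import numFieldNormedType.Exports.
Local Open Scope classical_set_scope.
Local Open Scope ring_scope.

Definition knot {R : realType} (h : R) (j : int) : R := j%:~R * h.

Fixpoint bspline {R : realType} (h : R) (p : nat) (j : int) (x : R) : R :=
  match p with
  | 0%N => if knot h j <= x < knot h (j + 1) then 1 else 0
  | q.+1 =>
      (x - knot h j) / (knot h (j + p%:Z) - knot h j) * bspline h q j x
      + (knot h (j + p%:Z + 1) - x)
          / (knot h (j + p%:Z + 1) - knot h (j + 1)) * bspline h q (j + 1) x
  end.

(* The derivative and its library default value at the finitely many points
   where a degree-1 spline has a kink do not affect the Lebesgue integral. *)
Definition stiffness_integrand {R : realType} (h : R) (p : nat) (j k : int)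
    (x : R) : R :=
  (bspline h p j)^`()%classic x * (bspline h p (j + k))^`()%classic x.

Definition mass_integrand {R : realType} (h : R) (p : nat) (j k : int)
    (x : R) : R :=
  bspline h p j x * bspline h p (j + k) x.

(* [stiffness h p j k] is A^{j+k}_p and [mass h p j k] is B^{j+k}_p. *)
Definition stiffness {R : realType} (h : R) (p : nat) (j k : int) : R :=
  h * \int[lebesgue_measure]_x stiffness_integrand h p j k x.

Definition mass {R : realType} (h : R) (p : nat) (j k : int) : R :=
  h^-1 * \int[lebesgue_measure]_x mass_integrand h p j k x.

(* A rule on [0, 1] is a sequence of (weight, node) pairs. *)
Definition quad {R : realType} (Q : seq (R * R)) (f : {poly R}) : R :=
  \sum_(q <- Q) q.1 * f.[q.2].

Definition exact_up_to {R : realType} (d : nat) (Q : seq (R * R)) : Prop :=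
  forall f : {poly R}, (size f <= d.+1)%N ->
    quad Q f = \int[lebesgue_measure]_(x in `[0, 1]) f.[x].

(* Rodrigues' formula for the Legendre polynomial transported to [0, 1]. *)
Definition legendre {R : realType} (n : nat) : {poly R} :=
  n`!%:R^-1 *: (('X ^+ 2 - 'X) ^+ n)^`(n).

(* Nodes: the n distinct roots of the Legendre polynomial; weights: the
   integrals of the Lagrange cardinal polynomials of these nodes. *)
Definition gauss_legendre {R : realType} (n : nat) (G : seq (R * R)) : Prop :=
  [/\ size G = n,
      uniq [seq q.2 | q <- G],
      forall q : R * R, q \in G -> root (legendre n) q.2
    & forall q : R * R, q \in G ->
        q.1 = \int[lebesgue_measure]_(x in `[0, 1])
                \prod_(r <- G | r.2 != q.2) ((x - r.2) / (q.2 - r.2))].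

(* The polynomial that f is on the open element ]x_i, x_{i+1}[ (it is unique;
   the default value 0 is used when f is not a polynomial there).  Nodes at the
   end points of an element thus see the one-sided values of the integrand. *)
Definition element_poly {R : realType} (h : R) (i : int) (f : R -> R) :
    {poly R} :=
  xget 0 [set g : {poly R} |
          forall x, knot h i < x < knot h (i + 1) -> f x = g.[x]].

(* The functional I on the reference interval, applied on every element.  Only
   finitely many elements contribute when f has bounded support. *)
Definition composite {R : realType} (I : {poly R} -> R) (h : R) (f : R -> R) :
    R :=
  \sum_(i \in [set: int])
    h * I (element_poly h i f \Po ((knot h i)%:P + h *: 'X)).

Definition stiffness_quad {R : realType} (I : {poly R} -> R) (h : R) (p : nat)
    (j k : int) : R :=
  h * composite I h (stiffness_integrand h p j k).

Definition mass_quad {R : realType} (I : {poly R} -> R) (h : R) (p : nat)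
    (j k : int) : R :=
  h^-1 * composite I h (mass_integrand h p j k).

(* The entries do not depend on h and j, so quantifying over all grids below
   adds nothing; it keeps the properties intrinsic to the functional I. *)
Definition mass_exact {R : realType} (p : nat) (I : {poly R} -> R) : Prop :=
  forall (h : R) (j k : int), 0 < h -> mass_quad I h p j k = mass h p j k.

Definition optimal {R : realType} (p : nat) (I : {poly R} -> R) : Prop :=
  forall (h : R) (j : int) (m : nat), 0 < h -> (2 <= m <= p.+1)%N ->
    \sum_(1 <= k < p.+1)
      (k%:R ^+ (2 * m) / (2 * m)`!%:R * stiffness h p j k
       + k%:R ^+ (2 * m - 2) / (2 * m - 2)`!%:R * mass_quad I h p j k) = 0.

Definition tau {R : realType} (I : {poly R} -> R) (h : R) (p : nat) (j : int) :
    R :=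
  (\sum_(1 <= k < p.+1)
     (k%:R ^+ (2 * p + 2) / (2 * p + 2)`!%:R * stiffness_quad I h p j k
      + k%:R ^+ (2 * p) / (2 * p)`!%:R * mass_quad I h p j k))
  / (\sum_(1 <= k < p.+1)
       k%:R ^+ (2 * p) / (2 * p)`!%:R * (mass_quad I h p j k - mass h p j k)).

Definition blend {R : realType} (t : R) (I J : {poly R} -> R) (f : {poly R}) :
    R :=
  t * I f + (1 - t) * J f.

Definition approx_eigenvalue {R : realType} (I : {poly R} -> R) (h : R)
    (p : nat) (j : int) (mu : R) : R :=
  (h ^+ 2)^-1 *
  ((stiffness h p j 0
    + 2 * \sum_(1 <= k < p.+1) stiffness h p j k * cos (k%:R * mu * h))
   / (mass_quad I h p j 0
      + 2 * \sum_(1 <= k < p.+1) mass_quad I h p j k * cos (k%:R * mu * h))).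

(* Main.v *)
Require Import Defs.
From HB Require Import structures.
From mathcomp Require Import all_boot all_order all_algebra.
From mathcomp Require Import all_classical all_reals all_analysis.
From mathcomp Require Import ring lra zify.
Import Order.TTheory GRing.Theory Num.Theory.
Import numFieldNormedType.Exports.
Local Open Scope classical_set_scope.
Local Open Scope ring_scope.

Set Implicit Arguments.
Unset Strict Implicit.
Unset Printing Implicit Defensive.

(** The eigenvalue is h^-2 a(t) / b(t), where t = mu h and where
    a(t) = A_0 + 2 sum_k A_k cos(k t), b(t) = B_0 + 2 sum_k B_k cos(k t) are the
    symbols of the stiffness and of the blended mass matrix.  Up to sign, the
    coefficient of t^(2m) in a is the symmetric moment of order 2m of the
    entries ([sym_moment]), hence the coefficient of t^(2m) in a - t^2 b is, up
    to sign, a moment of A of order 2m plus a moment of B of order 2m - 2.  The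
    claim holds because these sums vanish for m <= p + 1 and because the moment
    of B of order 0 is 1: then a - t^2 b starts with the stated term in
    t^(2p+4), and b = 1 + O(t^2) ([eigenvalue_expansion]).  The entries depend
    neither on h nor on j, so that the constants in O are uniform.

    For exact integration and m <= p ([stiff_mass_moment]) the reason is
    polynomial reproduction.  Let N_i be the polynomial which the B-spline is on
    its i-th element, in the local coordinate X ([piece]).  For a polynomial g
    of degree at most p, the sum of the N_i g(X + i) is constant
    ([deriv_spline_sum0]).  Expanding (i - l)^n / n! = ((X + i) - (X + l))^n / n!
    by the binomial formula turns the moments of the products N_i N_l and
    N_i' N_l' into Cauchy products of the sequence
    h_a = sum_i N_i (X + i)^a / a! ([weak_form_cauchy]).  Each term contains the
    derivative of some h_a; for n <= 2p + 1 either this derivative is zero, or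
    it is multiplied by a constant and integrates to h_a(1) - h_a(0) = 0.

    A quadrature rule that is exact up to degree 2p - 2 errs on the mass entries
    by multiples of one number.  Indeed the polynomial integrated on the
    reference interval for the k-th entry has degree at most 2p and is invariant
    under X -> 1 - X, so that it is a multiple of (X (1 - X))^p up to degree 2p - 2
    ([sym_poly_top]).  The multiple is a leading coefficient, and the leading
    coefficients of the N_i form a p-th finite difference
    ([lead_piece_moment]); therefore the error does not affect the moments of
    order less than 2p, and it changes the moment of order 2p by a nonzero
    factor times the error on (X (1 - X))^p ([mass_moment_error]).  Since the
    mass entries are not all exact, this error is nonzero ([mass_error_neq0]):
    the denominator of tau does not vanish, and tau is the value for which the
    condition m = p + 1 holds, provided that the Gauss rule gives the exact mass
    entries ([gauss_legendre_exact]). *)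

(** * Polynomial auxiliaries *)

Lemma deriv_natr (R : nzRingType) n : (n%:R : {poly R})^`() = 0.
Proof. by rewrite -polyC_natr derivC. Qed.

Lemma intr_polyC (R : nzRingType) (i : int) : i%:~R = (i%:~R)%:P :> {poly R}.
Proof. by rewrite rmorph_int. Qed.

Lemma deriv_mulnat (R : nzRingType) n (f : {poly R}) :
  (n%:R * f)^`() = n%:R * f^`().
Proof. by rewrite derivM deriv_natr mul0r add0r. Qed.

Lemma deriv_intr (R : nzRingType) (i : int) : (i%:~R : {poly R})^`() = 0.
Proof. by rewrite intr_polyC derivC. Qed.

Lemma horner_natr (R : nzRingType) n (x : R) : (n%:R : {poly R}).[x] = n%:R.
Proof. by rewrite -polyC_natr hornerC. Qed.

Lemma horner_intr (R : nzRingType) (i : int) (x : R) :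
  (i%:~R : {poly R}).[x] = i%:~R.
Proof. by rewrite intr_polyC hornerC. Qed.

Lemma comp_natr (R : nzRingType) n (f : {poly R}) : n%:R \Po f = n%:R.
Proof. by rewrite -polyC_natr comp_polyC. Qed.

Lemma comp_intr (R : nzRingType) (i : int) (f : {poly R}) :
  i%:~R \Po f = i%:~R.
Proof. by rewrite intr_polyC comp_polyC. Qed.

Lemma natpoly_neq0 (R : numDomainType) n : n.+1%:R != 0 :> {poly R}.
Proof. by rewrite -polyC_natr polyC_eq0 pnatr_eq0. Qed.

(** * The polynomial pieces of a cardinal B-spline *)

Section CardinalPieces.
Variable R : numFieldType.
Implicit Types (f g : {poly R}) (i k : int) (p n : nat).

(** The polynomial that the degree-p B-spline with unit knots 0, ..., p + 1 is
    on [i, i + 1[, as a function of x - i.  The index is an integer in order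
    that the recurrence holds without boundary cases. *)
Fixpoint piece p i : {poly R} :=
  if p is q.+1 then
    (q.+1%:R^-1) *: (('X + i%:~R) * piece q i
                     + (q.+2%:R - i%:~R - 'X) * piece q (i - 1))
  else (i == 0)%:R.

Lemma pieceS p i : p.+1%:R * piece p.+1 i =
  ('X + i%:~R) * piece p i + (p.+2%:R - i%:~R - 'X) * piece p (i - 1).
Proof.
by rewrite mulr_natl -scaler_nat /= scalerA divff ?scale1r // pnatr_eq0.
Qed.

Lemma piece_out p i : ~~ (0 <= i <= p%:Z) -> piece p i = 0.
Proof.
elim: p i => [|p IH] i hi /=; first by case: eqP hi => // ->.
by rewrite !IH ?mulr0 ?addr0 ?scaler0 //; lia.
Qed.

Lemma size_piece p i : (size (piece p i) <= p.+1)%N.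
Proof.
elim: p i => [|p IH] i; first by rewrite /=; case: eqP;
  rewrite ?size_poly1 ?size_poly0.
apply: leq_trans (size_scale_leq _ _) _.
have aux (c : {poly R}) k : (size c <= 2)%N ->
    (size (c * piece p k)%R <= p.+2)%N.
  move=> hc; apply: leq_trans (size_polyMleq _ _) _.
  by have := IH k; lia.
rewrite (leq_trans (size_polyD _ _)) // geq_max !aux //.
- rewrite -polyC_natr intr_polyC -polyCB.
  rewrite (leq_trans (size_polyD _ _)) // geq_max size_polyN size_polyX andbT.
  by rewrite size_polyC; case: eqP.
- by rewrite intr_polyC size_XaddC.
Qed.

(** Difference formula for the derivative of a B-spline.  By induction: after
    differentiation, the two copies of the recurrence one degree below combine
    to p times the claimed difference. *)
Lemma deriv_piece p i : (piece p.+1 i)^`() = piece p i - piece p (i - 1).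
Proof.
elim: p i => [|p IH] i.
  apply: (mulfI (natpoly_neq0 R 0));
    rewrite -deriv_mulnat pieceS !(deriv_natr, derivM, derivB, derivD, derivN,
    deriv_intr, derivX).
  rewrite /= ?deriv_natr; ring.
apply: (mulfI (natpoly_neq0 R p.+1)).
rewrite -deriv_mulnat pieceS !(deriv_natr, derivM, derivB, derivD, derivN,
  deriv_intr, derivX) !IH.
have e1 := pieceS p i; have e2 := pieceS p (i - 1).
have e3 : p.+2%:R = p.+1%:R + 1 :> {poly R} by rewrite -natr1.
have e4 : p.+3%:R = p.+1%:R + 2 :> {poly R} by rewrite -natrD addn2.
have e5 : p.+2%:R * (piece p.+1 i - piece p.+1 (i - 1)) =
  p.+1%:R * piece p.+1 i - p.+1%:R * piece p.+1 (i - 1)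
  + (piece p.+1 i - piece p.+1 (i - 1)) by rewrite e3; ring.
rewrite e5 e1 e2 e4 e3 (intrD _ i).
ring.
Qed.

(** Continuity of splines of positive degree at the knots. *)
Lemma piece_joint p i : (piece p.+1 i).[0] = (piece p.+1 (i - 1)).[1].
Proof.
elim: p i => [|p IH] i.
  rewrite /= !(horner_natr, horner_intr, hornerZ, hornerM, hornerN, hornerX,
    hornerD).
  have [->|h0] := eqVneq i 0; first by rewrite /=; ring.
  have [->|h1] := eqVneq i 1; first by rewrite /=; ring.
  have -> : (i - 1 == 0) = false by lia.
  have [->|h2] := eqVneq i 2; first by rewrite /=; ring.
  have -> : (i - 1 - 1 == 0) = false by lia.
  by rewrite /=; ring.
have hE (q : nat) k x :
    (q.+1%:R * piece q.+1 k).[x] = q.+1%:R * (piece q.+1 k).[x].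
  by rewrite hornerM horner_natr.
apply: (mulfI (_ : p.+2%:R != 0)); first by rewrite pnatr_eq0.
rewrite -!hE !pieceS !(horner_natr, horner_intr, hornerM, hornerN, hornerX,
  hornerD) !IH.
rewrite !intrD; ring.
Qed.

Lemma piece_reflect p i : piece p (p%:Z - i) \Po (1 - 'X) = piece p i.
Proof.
elim: p i => [|p IH] i.
  by rewrite sub0r /= oppr_eq0 comp_natr.
apply: (mulfI (natpoly_neq0 R p)).
rewrite -[X in X * (_ \Po _)](comp_natr p.+1 (1 - 'X)) -comp_polyM !pieceS.
rewrite !(comp_natr, comp_intr, comp_polyM, comp_polyX, comp_polyB, comp_polyD).
have -> : p.+1%:Z - i = p%:Z - (i - 1) by lia.
have -> : p%:Z - (i - 1) - 1 = p%:Z - i by lia.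
rewrite !IH !intrD !mulrNz -!pmulrn.
rewrite -[p.+2%:R]natr1 -[p.+1%:R]natr1; ring.
Qed.

End CardinalPieces.

(** * Polynomial reproduction *)

Lemma coef_X1_exp (R : comNzRingType) n k :
  (('X + 1 : {poly R}) ^+ n)`_k = 'C(n, k)%:R.
Proof.
rewrite exprD1n coef_sum.
under eq_bigr do rewrite coefMn coefXn.
have [hk|hk] := ltnP k n.+1; last first.
  rewrite big1 ?bin_small // => i _.
  by case: eqP => [e|_]; rewrite ?mul0rn //; move: (ltn_ord i); lia.
rewrite (bigD1 (Ordinal hk)) //= eqxx big1 ?addr0 // => i hi.
by rewrite -val_eqE /= eq_sym in hi; rewrite (negPf hi) mul0rn.
Qed.

Definition fdiff (R : comNzRingType) (g : {poly R}) : {poly R} :=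
  g \Po ('X + 1) - g.

Lemma coef_fdiff (R : comNzRingType) (g : {poly R}) n :
  (size g <= n.+2)%N -> (fdiff g)`_n = g`_n.+1 *+ n.+1.
Proof.
move=> hg; rewrite coefB coef_comp_poly.
under eq_bigr do rewrite coef_X1_exp.
rewrite -(big_mkord xpredT (fun i => g`_i * 'C(i, n)%:R)).
rewrite (big_nat_widen _ _ n.+2) //= big_mkord.
rewrite big_mkcond /=.
rewrite (eq_bigr (fun i : 'I_n.+2 => g`_i * 'C(i, n)%:R)); last first.
  move=> i _; case: ltnP => // hi; by rewrite nth_default ?mul0r.
rewrite !big_ord_recr /= big1 ?add0r; last first.
  by move=> i _; rewrite bin_small // mulr0.
by rewrite binn mulr1 binSn mulr_natr addrAC subrr add0r.
Qed.

Lemma size_fdiff (R : comNzRingType) (g : {poly R}) n :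
  (size g <= n.+1)%N -> (size (fdiff g) <= n)%N.
Proof.
move=> hg; apply/leq_sizeP => k hk.
rewrite coef_fdiff ?(leq_trans hg) // ?nth_default ?mul0rn //.
- exact: leq_trans hg _.
- by rewrite ltnS (leq_trans hk).
Qed.

(** The second derivative makes [f] affine, and an affine function with equal
    values at two points is constant. *)
Lemma deriv_eq0_periodic (R : numDomainType) (f : {poly R}) :
  f^`()^`() = 0 -> f.[0] = f.[1] -> f^`() = 0.
Proof.
move=> f2 f01.
have sf : (size f <= 2)%N.
  apply/leq_sizeP => -[|[|k]] // _.
  have := congr1 (fun q : {poly R} => q`_k) f2;
    rewrite coef0 !coef_deriv -mulrnA.
  by move/eqP; rewrite mulrn_eq0 muln_eq0 /= => /eqP.
have f1 : f`_1 = 0.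
  move: f01; rewrite !(horner_coef_wide _ sf) !big_ord_recl !big_ord0 /=.
  rewrite /bump /= !expr1 !expr0 !mulr0 !mulr1 !addr0 => e.
  by apply: (addrI f`_0); rewrite addr0 {2}e.
apply/polyP => -[|k]; rewrite coef_deriv coef0 ?f1 ?mul0rn //.
by rewrite nth_default ?mul0rn // (leq_trans sf).
Qed.

Section PieceSums.
Variable R : numFieldType.
Implicit Types (f g : {poly R}) (i k : int) (p n : nat).
Local Notation piece := (@piece R).

(** Reindexing rules for sums over the elements of the support; [F] vanishes on
    the pieces outside the support, where a shift would leave a boundary
    term. *)
Section Shift.
Variables (V : nmodType) (F : {poly R} -> nat -> V).
Hypothesis F0 : forall n, F 0 n = 0.

Lemma sum_piece_widen p :
  \sum_(i < p.+2) F (piece p i%:Z) i = \sum_(i < p.+1) F (piece p i%:Z) i.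
Proof. by rewrite big_ord_recr /= piece_out ?F0 ?addr0 //; lia. Qed.

Lemma sum_piece_shift p :
  \sum_(i < p.+2) F (piece p (i%:Z - 1)) i =
  \sum_(i < p.+1) F (piece p i%:Z) i.+1.
Proof.
rewrite big_ord_recl /= piece_out // F0 add0r; apply: eq_bigr => i _.
by rewrite /bump /= -addn1 PoszD addrC addKr.
Qed.

End Shift.

Lemma partition_of_unity p : \sum_(i < p.+1) piece p i%:Z = 1.
Proof.
elim: p => [|p IH]; first by rewrite big_ord1.
apply: (mulfI (natpoly_neq0 R p)); rewrite mulr_sumr mulr1.
under eq_bigr do rewrite pieceS.
rewrite big_split /=.
rewrite (@sum_piece_widen _ (fun f n => ('X + n%:R) * f)); last by move=> n;
  rewrite mulr0.
rewrite (@sum_piece_shift _ (fun f n => (p.+2%:R - n%:R - 'X) * f));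
  last by move=> n; rewrite mulr0.
rewrite -big_split /= -[RHS]mulr1 -[X in _ = _ * X]IH mulr_sumr;
  apply: eq_bigr => i _.
rewrite -mulrDl; congr (_ * _).
by rewrite -[p.+2%:R]natr1 -[p.+1%:R]natr1 -[i.+1%:R]natr1; ring.
Qed.

(** The 1-periodic sum of all integer translates of the product of the B-spline
    and g, restricted to [0, 1[. *)
Definition spline_sum p g : {poly R} :=
  \sum_(i < p.+1) piece p i%:Z * (g \Po ('X + i%:R)).

Lemma deriv_spline_sum p g :
  (spline_sum p.+1 g)^`() = spline_sum p.+1 g^`() - spline_sum p (fdiff g).
Proof.
rewrite /spline_sum raddf_sum /=.
under eq_bigr => i _.
  rewrite derivM deriv_piece deriv_comp derivD derivX deriv_natr addr0 mulr1.
  rewrite mulrBl.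
  over.
rewrite big_split /= addrC; congr (_ + _).
rewrite big_split /= sumrN.
rewrite (@sum_piece_widen _ (fun f n => f * (g \Po ('X + n%:R))));
  last by move=> n; rewrite mul0r.
rewrite (@sum_piece_shift _ (fun f n => f * (g \Po ('X + n%:R))));
  last by move=> n; rewrite mul0r.
rewrite -sumrB -sumrN; apply: eq_bigr => i _.
rewrite /fdiff comp_polyB -comp_polyA comp_polyD comp_polyX (comp_natr 1).
by rewrite -addrA natr1 -mulrBr -mulrN opprB.
Qed.

(** For positive degree the periodic sum is continuous. *)
Lemma spline_sum_ends p g : (spline_sum p.+1 g).[0] = (spline_sum p.+1 g).[1].
Proof.
rewrite /spline_sum !horner_sum.
under eq_bigr do rewrite hornerM horner_comp hornerD hornerX horner_natr add0r.
under [RHS]eq_bigr => i _.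
  rewrite hornerM horner_comp hornerD hornerX horner_natr addrC natr1.
  have -> : i%:Z = i.+1%:Z - 1 by lia.
  rewrite -piece_joint.
  over.
rewrite big_ord_recl piece_joint piece_out // horner0 mul0r add0r.
rewrite [RHS]big_ord_recr (@piece_out _ p.+1 p.+2%:Z); last by lia.
by rewrite horner0 mul0r; apply/esym/addr0.
Qed.

(** By [deriv_spline_sum] the derivative is a combination of a sum of lower
    spline degree for a difference of g and of a sum of the same spline degree
    for g'; by the two inductions these are constant, so that the second
    derivative vanishes and periodicity gives the conclusion. *)
Lemma deriv_spline_sum0 p g :
  (size g <= p.+1)%N -> (spline_sum p g)^`() = 0.
Proof.
elim: p g => [|p IHp] g.
  by move=> /size1_polyC ->; rewrite /spline_sum big_ord1 comp_polyC /= mul1r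
    derivC.
have [n] := ubnP (size g); elim: n g => // n IHn g hn hg.
have [->|g0] := eqVneq g 0.
  by rewrite /spline_sum big1 ?deriv0 // => i _; rewrite comp_poly0 mulr0.
apply: deriv_eq0_periodic; last exact: spline_sum_ends.
have hlt := lt_size_deriv g0.
rewrite deriv_spline_sum derivB IHn ?sub0r; last first.
- by rewrite (leq_trans (ltnW hlt)).
- by apply: leq_trans hlt _.
by rewrite IHp ?oppr0 // size_fdiff.
Qed.

(** By [deriv_piece] the leading coefficients of the pieces are, up to 1 / p!,
    the coefficients of a p-th backward difference. *)
Lemma lead_piece_moment p g : (size g <= p.+1)%N ->
  \sum_(i < p.+1) (piece p i%:Z)`_p * g.[i%:R] = (-1) ^+ p * g`_p.
Proof.
elim: p g => [|p IH] g hg.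
  rewrite big_ord1 /= coef1 mul1r expr0 mul1r.
  by rewrite (size1_polyC hg) hornerC coefC.
have coefS k :
    p.+1%:R * (piece p.+1 k)`_p.+1 = (piece p k)`_p - (piece p (k - 1))`_p.
  by rewrite -coefB -deriv_piece coef_deriv mulr_natl.
apply: (mulfI (_ : p.+1%:R != 0)); first by rewrite pnatr_eq0.
rewrite mulr_sumr; under eq_bigr => i _ do rewrite mulrA coefS mulrBl.
rewrite sumrB.
rewrite (@sum_piece_widen _ (fun f n => f`_p * g.[n%:R])); last by move=> n;
  rewrite coef0 mul0r.
rewrite (@sum_piece_shift _ (fun f n => f`_p * g.[n%:R])); last by move=> n;
  rewrite coef0 mul0r.
rewrite -sumrB.
rewrite (eq_bigr (fun i : 'I_p.+1 =>
  - ((piece p i%:Z)`_p * (fdiff g).[i%:R]))); last first.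
  move=> i _; rewrite -mulrBr -mulrN hornerD hornerN horner_comp hornerD
    hornerX hornerC.
  by rewrite natr1 opprB.
rewrite sumrN IH ?size_fdiff // coef_fdiff // exprS mulrA -[_ *+ p.+1]mulr_natl.
by ring.
Qed.

End PieceSums.

(** * Integration on the reference interval, divided powers *)

Section Integral.
Variable R : numFieldType.
Implicit Types f g : {poly R}.

(** In degree 0 the formula is 0 because f`_0 / 0 = 0 by convention. *)
Definition primitive f : {poly R} := \poly_(i < (size f).+1) (f`_i.-1 / i%:R).

Lemma coef_primitive f i : (primitive f)`_i = f`_i.-1 / i%:R.
Proof.
rewrite coef_poly; case: ltnP => //; case: i => [|i] //=.
by rewrite ltnS => hi; rewrite nth_default ?mul0r.
Qed.

Lemma primitive_is_linear : linear primitive.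
Proof.
move=> a f g; apply/polyP => i.
by rewrite coefD coefZ !coef_primitive coefD coefZ mulrDl mulrA.
Qed.
HB.instance Definition _ := GRing.isLinear.Build R {poly R} {poly R} _ primitive
  primitive_is_linear.

Lemma deriv_primitive f : (primitive f)^`() = f.
Proof.
apply/polyP => i; rewrite coef_deriv coef_primitive /= -[_ *+ i.+1]mulr_natr.
by rewrite mulfVK ?pnatr_eq0.
Qed.

Lemma primitive_deriv f : primitive f^`() = f - (f`_0)%:P.
Proof.
apply/polyP => -[|i]; rewrite coef_primitive coefB coefC /=.
  by rewrite invr0 mulr0 subrr.
by rewrite coef_deriv subr0 -[_ *+ i.+1]mulr_natr mulfK // pnatr_eq0.
Qed.

Lemma primitive0 f : (primitive f).[0] = 0.
Proof. by rewrite horner_coef0 coef_primitive invr0 mulr0. Qed.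

Definition int01 f : R := (primitive f).[1].

Lemma int01_is_linear : linear_for *%R int01.
Proof. by move=> a f g; rewrite /int01 linearP hornerD hornerZ. Qed.
HB.instance Definition _ := GRing.isLinear.Build R {poly R} R *%R int01
  int01_is_linear.

Lemma int01_deriv f : int01 f^`() = f.[1] - f.[0].
Proof. by rewrite /int01 primitive_deriv hornerD hornerN hornerC horner_coef0.
  Qed.

Lemma deriv0_polyC f : f^`() = 0 -> f = (f`_0)%:P.
Proof. by move=> h; have := primitive_deriv f; rewrite h linear0 => /esym/eqP;
  rewrite subr_eq0 => /eqP. Qed.

End Integral.

Section Convolution.
Variable R : numFieldType.
Local Notation S := {poly R}.
Implicit Types (u v w : nat -> S) (c d f g x y : S).

(** Product and multiplication by the variable for power series with polynomial
    coefficients, given by their sequences of coefficients. *)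
Definition cauchy u v n : S := \sum_(a < n.+1) u (n - a)%N * v a.
Definition delay u n : S := if n is m.+1 then u m else 0.

Lemma cauchy_delayl u v n : cauchy (delay u) v n.+1 = cauchy u v n.
Proof.
rewrite /cauchy big_ord_recr /= subnn mul0r addr0; apply: eq_bigr => a _.
by rewrite subSn // -ltnS.
Qed.

Lemma cauchy_delayr u v n : cauchy u (delay v) n.+1 = cauchy u v n.
Proof. by rewrite /cauchy big_ord_recl /= mulr0 add0r. Qed.

Lemma cauchy_combl c d u w v n :
  cauchy (fun a => c * u a + d * w a) v n = c * cauchy u v n + d * cauchy w v n.
Proof.
rewrite /cauchy !mulr_sumr -big_split; apply: eq_bigr => a _ /=.
by ring.
Qed.

Lemma cauchy_combr c d u w v n :
  cauchy v (fun a => c * u a + d * w a) n = c * cauchy v u n + d * cauchy v w n.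
Proof.
rewrite /cauchy !mulr_sumr -big_split; apply: eq_bigr => a _ /=.
by ring.
Qed.

Lemma cauchy_scalel c u v n : cauchy (fun a => c * u a) v n = c * cauchy u v n.
Proof. by rewrite /cauchy mulr_sumr; apply: eq_bigr => a _; rewrite mulrA. Qed.

Lemma cauchy_scaler c u v n : cauchy u (fun a => c * v a) n = c * cauchy u v n.
Proof. by rewrite /cauchy mulr_sumr; apply: eq_bigr => a _; rewrite mulrCA. Qed.

Lemma eq_cauchy u u' v v' n : u =1 u' -> v =1 v' -> cauchy u v n = cauchy u' v'
  n.
Proof. by move=> hu hv; apply: eq_bigr => a _; rewrite hu hv. Qed.

Lemma cauchy_sum (I : finType) (u v : I -> nat -> S) n :
  \sum_i \sum_l cauchy (u i) (v l) n =
  cauchy (fun a => \sum_i u i a) (fun a => \sum_l v l a) n.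
Proof.
rewrite /cauchy.
under eq_bigr do rewrite exchange_big.
rewrite exchange_big; apply: eq_bigr => a _ /=.
by rewrite mulr_suml; apply: eq_bigr => i _; rewrite mulr_sumr.
Qed.

Definition divpow x n : S := n`!%:R^-1 *: x ^+ n.

(** The rule exp(x T) exp(y T) = exp((x + y) T) for exponential series. *)
Lemma cauchy_divpow x y n : cauchy (divpow x) (divpow y) n = divpow (x + y) n.
Proof.
rewrite /divpow exprDn scaler_sumr; apply: eq_bigr => a _.
rewrite -scalerAl -scalerAr scalerA -scalerMnr scalerMnl; congr (_ *: _).
rewrite -[_ *+ 'C(n, a)]mulr_natr.
have ha : (a <= n)%N by rewrite -ltnS.
have f0 k : k`!%:R != 0 :> R by rewrite pnatr_eq0 -lt0n fact_gt0.
apply: (mulfI (f0 n)); rewrite [RHS]mulrA divff // mul1r.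
rewrite -{1}(bin_fact ha) !natrM.
by field; rewrite !f0.
Qed.

Lemma scale_fact_natmul n f :
  n.+1`!%:R^-1 *: (f *+ n.+1) = n`!%:R^-1 *: f.
Proof.
rewrite -scalerMnr scalerMnl; congr (_ *: _).
rewrite factS natrM -mulr_natr; field.
by rewrite nat1r !pnatr_eq0 -lt0n fact_gt0.
Qed.

Lemma deriv_divpow x n : x^`() = 1 -> (divpow x n)^`() = delay (divpow x) n.
Proof.
move=> hx; rewrite /divpow derivZ deriv_exp hx mul1r.
by case: n => [|n]; rewrite ?scale_fact_natmul // mulr0n scaler0.
Qed.

Lemma deriv_divpowN x n : x^`() = -1 -> (divpow x n)^`() = - delay (divpow x) n.
Proof.
move=> hx; rewrite /divpow derivZ deriv_exp hx mulN1r mulNrn scalerN.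
case: n => [|n]; first by rewrite mulr0n scaler0.
by rewrite /= scale_fact_natmul.
Qed.

(** With two independent variables s and s' for the two factors, and
    G_n = f(s) g(s') (x(s) + y(s'))^n / n!, the left-hand side is the value on
    the diagonal of d_s d_s' G_(n+2) + d_s G_(n+1) - d_s' G_(n+1).  Each of the
    three terms is a Cauchy product of derivatives, without remainder. *)
Lemma weak_form_cauchy f g x y n : x^`() = 1 -> y^`() = -1 ->
  let u a := f * divpow x a in let v a := g * divpow y a in
  f^`() * g^`() * divpow (x + y) n.+2 + f * g * divpow (x + y) n =
  cauchy (fun a => (u a)^`()) (fun a => (v a)^`()) n.+2
  + cauchy (fun a => (u a)^`()) v n.+1 - cauchy u (fun a => (v a)^`()) n.+1.
Proof.
move=> hx hy u v.
have hu : (fun a => (u a)^`()) =1 (fun a => f^`() * divpow x a + f * delay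
  (divpow x) a).
  by move=> a; rewrite derivM deriv_divpow.
have hv : (fun a => (v a)^`()) =1 (fun a => g^`() * divpow y a + (- g) * delay
  (divpow y) a).
  by move=> a; rewrite derivM deriv_divpowN // mulrN mulNr.
rewrite (eq_cauchy _ hu hv) (eq_cauchy _ hu (frefl v)) (eq_cauchy _ (frefl u)
  hv).
rewrite !cauchy_combl !cauchy_combr !cauchy_scaler !cauchy_scalel
  !cauchy_delayl !cauchy_delayr !cauchy_divpow.
by ring.
Qed.

End Convolution.

(** * Galerkin orthogonality for the moments *)

Section Galerkin.
Variable R : numFieldType.
Local Notation piece := (@piece R).

Definition spline_moment p a : {poly R} := spline_sum p (divpow 'X a).

Lemma spline_momentE p a :
  spline_moment p a = \sum_(i < p.+1) piece p i%:Z * divpow ('X + i%:R) a.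
Proof.
apply: eq_bigr => i _; congr (_ * _).
by rewrite /divpow linearZ /= -{1}['X^a]/('X ^+ a) rmorphXn /= comp_polyX.
Qed.

Lemma spline_momentNE p a :
  (-1) ^+ a * spline_moment p a = \sum_(i < p.+1) piece p i%:Z * divpow (- ('X
    + i%:R)) a.
Proof.
rewrite spline_momentE mulr_sumr; apply: eq_bigr => i _.
by rewrite /divpow [in RHS]exprNn mulrCA [in RHS]scalerAr.
Qed.

Lemma deriv_spline_moment0 p a : (a <= p)%N -> (spline_moment p a)^`() = 0.
Proof.
move=> ha; apply: deriv_spline_sum0.
by rewrite /divpow (leq_trans (size_scale_leq _ _)) // size_polyXn.
Qed.

(** Each term of the three Cauchy products contains a derivative of some moment
    of the pieces.  As n + 2 <= 2p + 1, one of the two orders is at most p, and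
    the moment of this order is constant: the term is zero or it is a constant
    times an exact derivative of a periodic function. *)
Lemma int01_weak_form p n : (0 < p)%N -> (n < 2 * p)%N ->
  int01 (\sum_(i < p.+1) \sum_(l < p.+1)
    ((piece p i%:Z)^`() * (piece p l%:Z)^`() * divpow (i%:R - l%:R) n.+2
     + piece p i%:Z * piece p l%:Z * divpow (i%:R - l%:R) n)) = 0.
Proof.
case: p => // p _ hn.
pose k a := (-1) ^+ a * spline_moment p.+1 a.
have dk a : (k a)^`() = (-1) ^+ a * (spline_moment p.+1 a)^`().
  by rewrite /k -signr_odd !mulr_sign; case: odd; rewrite ?derivN.
have hends a : (spline_moment p.+1 a).[0] = (spline_moment p.+1 a).[1] by
  exact: spline_sum_ends.
have kends a : (k a).[0] = (k a).[1].
  by rewrite /k !hornerM hends -signr_odd; case: odd;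
    rewrite ?expr1 ?hornerN ?expr0 ?hornerC.
have -> : \sum_(i < p.+2) \sum_(l < p.+2)
    ((piece p.+1 i%:Z)^`() * (piece p.+1 l%:Z)^`() * divpow (i%:R - l%:R) n.+2
     + piece p.+1 i%:Z * piece p.+1 l%:Z * divpow (i%:R - l%:R) n) =
  cauchy (fun a => (spline_moment p.+1 a)^`()) (fun a => (k a)^`()) n.+2
  + cauchy (fun a => (spline_moment p.+1 a)^`()) k n.+1
  - cauchy (spline_moment p.+1) (fun a => (k a)^`()) n.+1.
  pose u (i : 'I_p.+2) a := piece p.+1 i%:Z * divpow ('X + i%:R) a.
  pose v (i : 'I_p.+2) a := piece p.+1 i%:Z * divpow (- ('X + i%:R)) a.
  have hu : spline_moment p.+1 =1 (fun a => \sum_i u i a) by move=> a;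
    rewrite spline_momentE.
  have hv : k =1 (fun a => \sum_i v i a) by move=> a;
    rewrite /k spline_momentNE.
  have hu' : (fun a => (spline_moment p.+1 a)^`()) =1 (fun a => \sum_i (u i
    a)^`()).
    by move=> a; rewrite hu raddf_sum.
  have hv' : (fun a => (k a)^`()) =1 (fun a => \sum_i (v i a)^`()).
    by move=> a; rewrite hv raddf_sum.
  rewrite (eq_cauchy _ hu' hv') (eq_cauchy _ hu' hv) (eq_cauchy _ hu hv').
  rewrite -!cauchy_sum -big_split -sumrB; apply: eq_bigr => i _ /=.
  rewrite -big_split -sumrB; apply: eq_bigr => l _ /=.
  have -> : i%:R - l%:R = ('X + i%:R) + - ('X + l%:R) :> {poly R} by ring.
  by apply: weak_form_cauchy; rewrite ?derivN derivD derivX deriv_natr addr0.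
(* an exact derivative of a periodic function, times a constant *)
have const_mul f g : f^`() = 0 -> g.[0] = g.[1] -> int01 (f * g^`()) = 0 :> R.
  move=> /deriv0_polyC -> hg.
  by rewrite mul_polyC linearZ /= int01_deriv hg subrr mulr0.
rewrite !linearB linearD /= /cauchy !raddf_sum /=.
rewrite !big1 ?addr0 ?subrr // => a _.
- apply/eqP; rewrite oppr_eq0; apply/eqP.
  have [ha|ha] := leqP (n.+1 - a) p.+1.
    by apply: const_mul; rewrite ?deriv_spline_moment0.
  by rewrite dk deriv_spline_moment0 ?mulr0 ?linear0 //; move: (ltn_ord a); lia.
- have [ha|ha] := leqP a p.+1.
    by rewrite mulrC; apply: const_mul;
      rewrite // dk deriv_spline_moment0 ?mulr0.
  by rewrite deriv_spline_moment0 ?mul0r ?linear0 //; move: (ltn_ord a); lia.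
- have [ha|ha] := leqP a p.+1.
    by rewrite dk (deriv_spline_moment0 ha) !mulr0 linear0.
  by rewrite deriv_spline_moment0 ?mul0r ?linear0 //; move: (ltn_ord a); lia.
Qed.

End Galerkin.

(** * Autocorrelations and symmetric moments *)

Lemma sum_by_diagonals (V : comNzRingType) (c : nat -> nat -> V) n :
  (forall i l, c i l = c l i) ->
  \sum_(i < n) \sum_(l < n) c i l =
  \sum_(i < n) c i i + 2 * \sum_(1 <= k < n) \sum_(k <= i < n) c i (i - k)%N.
Proof.
move=> cC; elim: n => [|n IH].
  by rewrite !big_ord0 big_geq // mulr0 addr0.
rewrite big_ord_recr /=.
under eq_bigr do rewrite big_ord_recr /=.
rewrite big_split /= IH [in RHS]big_ord_recr /= [X in _ + X = _]big_ord_recr /=.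
have -> : \sum_(1 <= k < n.+1) \sum_(k <= i < n.+1) c i (i - k)%N =
   \sum_(1 <= k < n) \sum_(k <= i < n) c i (i - k)%N + \sum_(i < n) c n i.
  rewrite big_nat (eq_bigr (fun k => \sum_(k <= i < n) c i (i - k)%N + c n (n -
    k)%N)); last first.
    by move=> k /andP[_ hk]; rewrite big_nat_recr.
  rewrite -big_nat big_split /=; congr (_ + _).
    case: n {IH} => [|n]; first by rewrite !big_geq.
    by rewrite big_nat_recr //= [X in _ + X]big_geq // addr0.
  rewrite big_add1 /= big_mkord (reindex_inj rev_ord_inj) /=.
  by apply: eq_bigr => i _; congr (c _ _); have := ltn_ord i; lia.
under [X in _ + X + _ = _]eq_bigr do rewrite cC.
by ring.
Qed.

Section Correlation.
Variable R : numFieldType.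
Implicit Types (f g : {poly R}).

Definition autocorr p (w : int -> {poly R}) (k : int) : {poly R} :=
  \sum_(i < p.+1) w i%:Z * w (i%:Z - k).

Section Support.
Variables (p : nat) (w : int -> {poly R}).
Hypothesis w_out : forall i, ~~ (0 <= i <= p%:Z) -> w i = 0.

Lemma autocorr_nat (k : nat) :
  autocorr p w k = \sum_(k <= i < p.+1) w i%:Z * w (i - k)%N%:Z.
Proof.
rewrite /autocorr big_geq_mkord [RHS]big_mkcond /=; apply: eq_bigr => i _.
case: leqP => hk; first by congr (_ * w _); lia.
by rewrite [X in _ * X]w_out ?mulr0 //; lia.
Qed.

Lemma autocorrN_nat (k : nat) :
  autocorr p w (- k%:Z) = \sum_(k <= i < p.+1) w i%:Z * w (i - k)%N%:Z.
Proof.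
rewrite /autocorr -[X in _ = \sum_(X <= _ < _) _]add0n big_addn.
rewrite -(big_mkord xpredT (fun i => w i%:Z * w (i%:Z - - k%:Z))).
rewrite (@big_cat_nat _ _ _ (p.+1 - k)) ?leq_subr //= [X in _ + X]big_nat addrC
  big1 ?add0r.
  rewrite !big_mkord; apply: eq_bigr => i _; rewrite mulrC addnK.
  by congr (w _ * w _); lia.
by move=> i hi; rewrite [X in _ * X]w_out ?mulr0 //; lia.
Qed.

Lemma autocorrN (k : int) : autocorr p w (- k) = autocorr p w k.
Proof.
case: k => k; first by rewrite autocorrN_nat autocorr_nat.
by rewrite NegzE opprK autocorrN_nat autocorr_nat.
Qed.

Lemma toeplitz_sum m :
  \sum_(i < p.+1) \sum_(l < p.+1)
     w i%:Z * w l%:Z * divpow (i%:R - l%:R) (2 * m) =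
  (m == 0%N)%:R * autocorr p w 0 +
  2 * \sum_(1 <= k < p.+1) divpow k%:R (2 * m) * autocorr p w k%:Z.
Proof.
rewrite (@sum_by_diagonals _ (fun i l => w i%:Z * w l%:Z * divpow (i%:R - l%:R)
  (2 * m))); last first.
  move=> i l; rewrite [w i%:Z * _]mulrC; congr (_ * _).
  by rewrite /divpow -[i%:R - _]opprB exprNn exprM sqrrN expr1n expr1n mul1r.
congr (_ + 2 * _).
  rewrite /autocorr mulr_sumr; apply: eq_bigr => i _.
  rewrite subrr subr0 /divpow expr0n muln_eq0 /= mulrC.
  by case: (m =P 0%N) => [->|_]; rewrite ?scaler0 // muln0 fact0 invr1 scale1r.
apply: eq_bigr => k _; rewrite autocorr_nat mulr_sumr;
  apply: eq_big_nat => i /andP[hi _].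
by rewrite mulrC natrB // opprB addrC subrK.
Qed.

End Support.

(** Up to the sign (-1)^m, the coefficient of t^(2m) in the symbol
    a_0 + 2 sum_k a_k cos(k t). *)
Definition sym_moment p (a : nat -> R) m : R :=
  (m == 0%N)%:R * a 0%N +
  2 * \sum_(1 <= k < p.+1) k%:R ^+ (2 * m) / (2 * m)`!%:R * a k.

Lemma divpow_natM (k n : nat) f :
  divpow k%:R n * f = (k%:R ^+ n / n`!%:R) *: f.
Proof. by rewrite /divpow -!polyC_natr -polyC_exp -mul_polyC -polyCM mul_polyC
  mulrC. Qed.

Lemma sym_moment_autocorr p w (I : {scalar {poly R}}) m :
  (forall i, ~~ (0 <= i <= p%:Z) -> w i = 0) ->
  I (\sum_(i < p.+1) \sum_(l < p.+1)
     w i%:Z * w l%:Z * divpow (i%:R - l%:R) (2 * m)) =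
  sym_moment p (fun k => I (autocorr p w k%:Z)) m.
Proof.
move=> hw; rewrite toeplitz_sum // linearD; congr (_ + _).
  by case: eqP => _; rewrite ?mul1r // !mul0r linear0.
rewrite !mulr_natl linearMn; congr (_ *+ _); rewrite raddf_sum.
by apply: eq_bigr => k _; rewrite /= divpow_natM linearZ.
Qed.

(** On the reference interval, the sum over all elements of the integrand of the
    k-th mass entry; [stiff_poly] is its analogue for the stiffness. *)
Definition mass_poly p := autocorr p (piece R p).
Definition stiff_poly p := autocorr p (fun i => (piece R p i)^`()).

Lemma piece_deriv_out p (i : int) :
  ~~ (0 <= i <= p%:Z) -> (piece R p i)^`() = 0.
Proof. by move=> hi; rewrite piece_out // deriv0. Qed.

Lemma mass_moment0 p (I : {scalar {poly R}}) :
  sym_moment p (fun k => I (mass_poly p k%:Z)) 0 = I 1.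
Proof.
rewrite -sym_moment_autocorr; last exact: piece_out.
congr (I _); under eq_bigr => i _.
  under eq_bigr do rewrite /divpow muln0 fact0 invr1 scale1r expr0 mulr1.
  rewrite -mulr_sumr partition_of_unity mulr1.
  over.
exact: partition_of_unity.
Qed.

Lemma stiff_moment0 p (I : {scalar {poly R}}) :
  sym_moment p (fun k => I (stiff_poly p k%:Z)) 0 = 0.
Proof.
rewrite -sym_moment_autocorr; last exact: piece_deriv_out.
rewrite big1 ?linear0 // => i _.
under eq_bigr do rewrite /divpow muln0 fact0 invr1 scale1r expr0 mulr1.
by rewrite -mulr_sumr -raddf_sum /= partition_of_unity /= derivC mulr0.
Qed.

Lemma stiff_mass_moment p m : (0 < p)%N -> (m < p)%N ->
  sym_moment p (fun k => int01 (stiff_poly p k%:Z)) m.+1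
  + sym_moment p (fun k => int01 (mass_poly p k%:Z)) m = 0.
Proof.
move=> hp hm.
rewrite -!(@sym_moment_autocorr _ _ (@int01 R)); try exact: piece_deriv_out;
  try exact: piece_out.
rewrite -linearD -big_split /= -[RHS](@int01_weak_form R p (2 * m) hp);
  last by lia.
congr (int01 _); apply: eq_bigr => i _; rewrite -big_split /=.
by rewrite mulnS.
Qed.

End Correlation.

(** * Quadrature error of the mass entries *)

Section QuadratureError.
Variable R : numFieldType.
Local Notation piece := (@piece R).
Implicit Types (f g : {poly R}).

Lemma coefM_top f g m n : (size f <= m.+1)%N -> (size g <= n.+1)%N ->
  (f * g)`_(m + n) = f`_m * g`_n.
Proof.
move=> hf hg; rewrite coefM.
have hm : (m < (m + n).+1)%N by rewrite ltnS leq_addr.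
rewrite (bigD1 (Ordinal hm)) //= addKn big1 ?addr0 // => i hi.
rewrite -val_eqE /= in hi.
have [h|h] := ltnP m i; first by rewrite nth_default ?mul0r // (leq_trans hf).
by rewrite [X in _ * X]nth_default ?mulr0 // (leq_trans hg) //; lia.
Qed.

Lemma size_mass_poly p k : (size (mass_poly R p k) <= (2 * p).+1)%N.
Proof.
apply: (leq_trans (size_sum _ _ _)); apply/bigmax_leqP => i _.
apply: (leq_trans (size_polyMleq _ _)).
by have := size_piece R p i%:Z; have := size_piece R p (i%:Z - k); lia.
Qed.

Lemma size_stiff_poly p k : (0 < p)%N ->
  (size (stiff_poly R p k) <= (2 * p - 2).+1)%N.
Proof.
case: p => // p _.
have hs i : (size (piece p.+1 i)^`() <= p.+1)%N.
  by rewrite (leq_trans (size_poly _ _)) //; have := size_piece R p.+1 i; lia.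
apply: (leq_trans (size_sum _ _ _)); apply/bigmax_leqP => i _.
apply: (leq_trans (size_polyMleq _ _)).
by have := hs i%:Z; have := hs (i%:Z - k); lia.
Qed.

(** The reflection of the B-spline exchanges the two factors of the
    correlation, which is even in k. *)
Lemma mass_poly_reflect p k : mass_poly R p k \Po (1 - 'X) = mass_poly R p k.
Proof.
have hr i : piece p i \Po (1 - 'X) = piece p (p%:Z - i).
  by rewrite -[RHS](piece_reflect R p (p%:Z - i)) opprB addrCA subrr addr0.
rewrite /mass_poly -[RHS](autocorrN (@piece_out R p)) /autocorr.
rewrite [RHS](reindex_inj rev_ord_inj) raddf_sum; apply: eq_bigr => i _ /=.
rewrite comp_polyM !hr; have := ltn_ord i => hi.
by congr (piece p _ * piece p _); lia.
Qed.

Lemma size_1subX_exp n : (size ((1 - 'X : {poly R}) ^+ n) <= n.+1)%N.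
Proof.
rewrite (leq_trans (size_poly_exp_leq _ _)) // ltnS.
have -> : 1 - 'X = - ('X - 1%:P) :> {poly R} by rewrite opprB.
by rewrite size_polyN size_XsubC mul1n.
Qed.

Lemma coef_1subX_exp n : ((1 - 'X : {poly R}) ^+ n)`_n = (-1) ^+ n.
Proof.
elim: n => [|n IH]; first by rewrite !expr0 coef1.
rewrite exprS -[n.+1]add1n coefM_top ?size_1subX_exp // ?IH.
  by rewrite coefB coef1 coefX /= sub0r exprS.
exact: (size_1subX_exp 1).
Qed.

Lemma coef_comp_1subX g n : (size g <= n.+1)%N ->
  (g \Po (1 - 'X))`_n = (-1) ^+ n * g`_n.
Proof.
rewrite leq_eqVlt ltnS coef_comp_poly => /predU1P[sg|sg].
  rewrite sg big_ord_recr /= coef_1subX_exp big1 ?add0r 1?mulrC // => i _.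
  by rewrite [X in _ * X]nth_default ?mulr0 // (leq_trans (size_1subX_exp _)).
rewrite big1 ?[g`_n]nth_default ?mulr0 // => i _.
rewrite [X in _ * X]nth_default ?mulr0 // (leq_trans (size_1subX_exp _)) //.
exact: leq_trans (ltn_ord i) sg.
Qed.

Definition bump_poly p : {poly R} := ((1 - 'X) * 'X) ^+ p.

(** Subtracting the right multiple of (X (1 - X))^p removes the term of degree
    2p; the rest is invariant under X -> 1 - X, hence has even degree, and the
    term of degree 2p - 1 is absent too. *)
Lemma sym_poly_top f p : (0 < p)%N -> (size f <= (2 * p).+1)%N ->
  f \Po (1 - 'X) = f ->
  (size (f - ((-1) ^+ p * f`_(2 * p)%N) *: bump_poly p)%R <= 2 * p - 1)%N.
Proof.
move=> hp sf hf; set g := f - _.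
have sq : size ((1 - 'X) * 'X : {poly R}) = 3%N.
  have -> : 1 - 'X = - ('X - 1%:P) :> {poly R} by rewrite opprB.
  by rewrite mulNr size_polyN size_mulX ?polyXsubC_eq0 // size_XsubC.
have sb : (size (bump_poly p) <= (2 * p).+1)%N.
  by rewrite (leq_trans (size_poly_exp_leq _ _)) // sq mulnC.
have lb : (bump_poly p)`_(2 * p) = (-1) ^+ p.
  rewrite /bump_poly; elim: p {hp sf g sb} => [|p IH];
    first by rewrite !expr0 coef1.
  have -> : (2 * p.+1 = 2 + 2 * p)%N by lia.
  rewrite exprS coefM_top ?sq // ?IH ?exprS; last first.
    by rewrite (leq_trans (size_poly_exp_leq _ _)) // sq mulnC.
  by rewrite mulrBl mul1r coefB coefX -expr2 coefXn /= sub0r.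
have sg0 : (size g <= (2 * p).+1)%N.
  rewrite (leq_trans (size_polyD _ _)) // geq_max sf size_polyN.
  by rewrite (leq_trans (size_scale_leq _ _)).
have g2p : g`_(2 * p) = 0.
  rewrite coefB coefZ lb mulrAC -expr2 sqrr_sign mul1r.
  by rewrite subrr.
have hg : g \Po (1 - 'X) = g.
  rewrite comp_polyB hf comp_polyZ /bump_poly rmorphXn /= comp_polyM comp_polyB
    comp_polyX.
  have e : 1 - (1 - 'X) = 'X :> {poly R} by ring.
  by rewrite (comp_natr 1) e ['X * _]mulrC.
have sg1 : (size g <= 2 * p)%N.
  apply/leq_sizeP => k; rewrite leq_eqVlt => /predU1P[<- //|hk].
  by rewrite nth_default // (leq_trans sg0).
have top : g`_(2 * p).-1 = 0.
  have := @coef_comp_1subX g (2 * p).-1;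
    rewrite prednK ?muln_gt0 // => /(_ sg1).
  rewrite hg -signr_odd; have -> : odd (2 * p).-1 by lia.
  by move=> /eqP; rewrite expr1 mulN1r -addr_eq0 -mulr2n mulrn_eq0 /= => /eqP.
apply/leq_sizeP => k; rewrite leq_eqVlt => /predU1P[<- //|hk].
  by rewrite subn1.
by rewrite nth_default // (leq_trans sg1) //; lia.
Qed.

(** In the binomial expansion of (i - l)^r, one factor is a moment of the leading
    coefficients of order less than p, which is zero, unless r = 2p and both
    orders are p. *)
Lemma sum_lead_moment p r : (r <= 2 * p)%N ->
  \sum_(i < p.+1) \sum_(l < p.+1)
    (piece p i%:Z)`_p * (piece p l%:Z)`_p * (i%:R - l%:R) ^+ r =
  (r == 2 * p)%:R * ((-1) ^+ p * 'C(2 * p, p)%:R).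
Proof.
move=> hr.
pose M a := \sum_(i < p.+1) (piece p i%:Z)`_p * i%:R ^+ a.
have ME a : (a <= p)%N -> M a = (a == p)%:R * (-1) ^+ p.
  move=> ha.
  have := @lead_piece_moment R p 'X^a; rewrite size_polyXn ltnS => /(_ ha).
  rewrite coefXn eq_sym mulrC => <-; apply: eq_bigr => i _; by rewrite hornerXn.
transitivity (\sum_(a < r.+1) M (r - a)%N * M a * ((-1) ^+ a * 'C(r, a)%:R)).
  under eq_bigr => i _ do under eq_bigr => l _ do rewrite exprBn mulr_sumr.
  under eq_bigr do rewrite exchange_big /=.
  rewrite exchange_big /=; apply: eq_bigr => a _.
  rewrite /M mulr_suml mulr_suml; apply: eq_bigr => i _.
  rewrite mulr_sumr mulr_suml; apply: eq_bigr => l _.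
  by rewrite -mulr_natr; ring.
have [->|hr'] := eqVneq r (2 * p)%N.
  have hp : (p < (2 * p).+1)%N by lia.
  rewrite (bigD1 (Ordinal hp)) //= big1 ?addr0.
    have -> : (2 * p - p = p)%N by lia.
    by rewrite ME // eqxx !mul1r -expr2 sqrr_sign mul1r.
  move=> a; rewrite -val_eqE /= => ha; have ha' := ltn_ord a.
  have [h|h] := ltnP a p.
    by rewrite [M a]ME ?(ltnW h) // (ltn_eqF h) mul0r mulr0 mul0r.
  rewrite ME; last by lia.
  have -> : (2 * p - a == p)%N = false by lia.
  by rewrite !mul0r.
rewrite big1 ?mul0r // => a _; have ha := ltn_ord a.
have [h|h] := ltnP a p.
  by rewrite [M a]ME ?(ltnW h) // (ltn_eqF h) mul0r mulr0 mul0r.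
rewrite ME; last by lia.
have -> : (r - a == p)%N = false by lia.
by rewrite !mul0r.
Qed.

Section Exactness.
Variables (I : {scalar {poly R}}) (p : nat).
Hypothesis hp : (0 < p)%N.
Hypothesis I_exact : forall f, (size f <= 2 * p - 1)%N -> I f = int01 f.

Lemma sym_poly_error f : (size f <= (2 * p).+1)%N -> f \Po (1 - 'X) = f ->
  I f - int01 f =
  (-1) ^+ p * f`_(2 * p) * (I (bump_poly p) - int01 (bump_poly p)).
Proof.
move=> sf hf; set c := _ * f`_(2 * p); set g := bump_poly p.
have IE (J : {scalar {poly R}}) : J (f - c *: g) = J f - c * J g.
  by rewrite raddfB /= [J (c *: g)](linearZ_LR J).
have := I_exact (sym_poly_top hp sf hf); rewrite !IE => h.
by rewrite -[I f](subrK (c * I g)) h; ring.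
Qed.

Lemma mass_moment_error m : (m <= p)%N ->
  sym_moment p (fun k => I (mass_poly R p k%:Z)) m
  - sym_moment p (fun k => int01 (mass_poly R p k%:Z)) m =
  (m == p)%:R * ('C(2 * p, p)%:R / (2 * p)`!%:R
    * (I (bump_poly p) - int01 (bump_poly p))).
Proof.
move=> hm.
rewrite -!sym_moment_autocorr; try exact: piece_out.
set S := \sum_(i < p.+1) _.
have ST := toeplitz_sum (@piece_out R p) m.
have sS : (size S <= (2 * p).+1)%N.
  apply: (leq_trans (size_sum _ _ _)); apply/bigmax_leqP => i _.
  apply: (leq_trans (size_sum _ _ _)); apply/bigmax_leqP => l _.
  rewrite mulrC -!polyC_natr -polyCB /divpow -polyC_exp -mul_polyC -polyCM
    mul_polyC.
  rewrite (leq_trans (size_scale_leq _ _)) // (leq_trans (size_polyMleq _ _))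
    //.
  by have := size_piece R p i%:Z; have := size_piece R p l%:Z; lia.
have hS : S \Po (1 - 'X) = S.
  rewrite /S ST comp_polyD comp_polyM comp_natr [_ 0 \Po _]mass_poly_reflect.
  rewrite comp_polyM (comp_natr 2) raddf_sum; congr (_ + _ * _).
  by apply: eq_bigr => k _; rewrite /= !divpow_natM comp_polyZ
    mass_poly_reflect.
rewrite (sym_poly_error sS hS).
have -> : S`_(2 * p) = (2 * m == 2 * p)%N%:R * ((-1) ^+ p * 'C(2 * p, p)%:R) /
  (2 * m)`!%:R.
  rewrite -(@sum_lead_moment p (2 * m)); last by lia.
  rewrite coef_sum mulr_suml; apply: eq_bigr => i _.
  rewrite coef_sum mulr_suml; apply: eq_bigr => l _.
  rewrite mulrC -!polyC_natr -polyCB /divpow -polyC_exp -mul_polyC -polyCM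
    mul_polyC.
  rewrite coefZ [(2 * p)%N]mul2n -addnn coefM_top ?size_piece //.
  by ring.
have -> : (2 * m == 2 * p)%N = (m == p) by lia.
have [->|_] := eqVneq m p; last by rewrite !mul0r mulr0 mul0r.
rewrite !mul1r !mulrA -expr2 sqrr_sign.
by rewrite mul1r.
Qed.

End Exactness.
End QuadratureError.

(** * Lebesgue integrals of piecewise polynomials *)

Section LebesguePolynomials.
Variable R : realType.
Local Notation mu := (@lebesgue_measure R).
Implicit Types (f : R -> R) (g : {poly R}) (a b : R).

Lemma integrable_setU_disjoint (A B : set R) f :
  measurable A -> measurable B -> [disjoint A & B] ->
  mu.-integrable A (EFin \o f) -> mu.-integrable B (EFin \o f) ->
  mu.-integrable (A `|` B) (EFin \o f).
Proof.
move=> mA mB AB fA fB.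
rewrite integrable_mkcond; last exact: measurableU.
rewrite integrable_mkcond // in fA; rewrite integrable_mkcond // in fB.
have := integrableD measurableT fA fB; apply: eq_integrable => // x _ /=.
rewrite !patchE in_setU.
have := @disj_setPS _ A B.
case: (boolP (x \in A)) => xA; case: (boolP (x \in B)) => xB;
  rewrite /= ?adde0 ?add0e //.
by move=> _; move/disj_setPS: AB => /(_ x);
  rewrite -in_setE in_setI xA xB => /(_ isT).
Qed.

Lemma integrable_horner a b g : mu.-integrable `[a, b] (EFin \o horner g).
Proof.
apply: continuous_compact_integrable; first exact: segment_compact.
by apply: continuous_subspaceT; exact: continuous_horner.
Qed.

Lemma Rintegral_horner a b g : a < b ->
  \int[mu]_(x in `[a, b]) g.[x] = (primitive g).[b] - (primitive g).[a].
Proof.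
move=> ab; rewrite /Rintegral (@continuous_FTC2 _ (horner g) (horner (primitive
  g)) a b ab) //.
- by apply: continuous_subspaceT; exact: continuous_horner.
- split.
  + by move=> x _; exact: derivable_horner.
  + by apply: cvg_at_right_filter; exact: continuous_horner.
  + by apply: cvg_at_left_filter; exact: continuous_horner.
- by move=> x _; rewrite derive1E derive_val deriv_primitive.
Qed.

(** Only the open interval matters: [f] may take any value at [a], as does the
    derivative of a piecewise linear spline. *)
Lemma Rintegral_element a b f g : a < b ->
  (forall x, a < x < b -> f x = g.[x]) ->
  mu.-integrable `[a, b[ (EFin \o f) /\
  \int[mu]_(x in `[a, b[) f x = (primitive g).[b] - (primitive g).[a].
Proof.
move=> ab fg.
have gi : mu.-integrable `]a, b[ (EFin \o horner g).
  apply: integrableS (integrable_horner a b g) => //.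
  exact: subset_itv_oo_cc.
have gci : mu.-integrable `[a, b[ (EFin \o horner g).
  apply: integrableS (integrable_horner a b g) => //.
  by apply: subset_itvl; rewrite bnd_simp.
have fi : mu.-integrable `]a, b[ (EFin \o f).
  apply: eq_integrable gi => // x; rewrite inE /= in_itv /= => hx.
  by rewrite fg.
split.
  rewrite -(@setU1itv _ _ (BLeft b) a false) ?bnd_simp //.
  apply: integrable_setU_disjoint => //.
    apply/disj_setPS => x [/= ->]; by rewrite in_itv /= ltxx.
  have := integrable_horner a a (f a)%:P; rewrite set_itv1.
  by apply: eq_integrable => // x; rewrite inE /= => ->; rewrite hornerC.
rewrite -Rintegral_itv_obnd_cbnd // -Rintegral_horner //
  -Rintegral_itv_bndo_bndc //.
rewrite -Rintegral_itv_obnd_cbnd //.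
by apply: eq_Rintegral => x; rewrite inE /= in_itv /= => /fg.
Qed.

Lemma Rintegral_elements (a : nat -> R) (g : nat -> {poly R}) f n :
  (forall i, a i < a i.+1) ->
  (forall i x, (i < n)%N -> a i < x < a i.+1 -> f x = (g i).[x]) ->
  mu.-integrable `[a 0%N, a n[ (EFin \o f) /\
  \int[mu]_(x in `[a 0%N, a n[) f x =
  \sum_(i < n) ((primitive (g i)).[a i.+1] - (primitive (g i)).[a i]).
Proof.
move=> ha; elim: n => [|n IH] hf.
  rewrite set_itvco0 big_ord0 Rintegral_set0; split=> //.
  exact: integrable_set0.
have [|i1 e1] := IH; first by move=> i x hi; apply: hf; rewrite ltnW.
have [i2 e2] := Rintegral_element (ha n) (fun x => hf n x (ltnSn n)).
have a0n : a 0%N <= a n.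
  elim: {IH hf i1 e1 i2 e2} n => // n IH; exact: le_trans IH (ltW (ha n)).
have U : `[a 0%N, a n.+1[%classic = `[a 0%N, a n[ `|` `[a n, a n.+1[.
  by rewrite -itv_bndbnd_setU // bnd_simp // ltW.
have D : [disjoint `[a 0%N, a n[ & `[a n, a n.+1[].
  apply/disj_setPS => x [/=]; rewrite !in_itv /= => /andP[_ h1] /andP[h2 _].
  by move: (lt_le_trans h1 h2); rewrite ltxx.
rewrite U; have i12 := integrable_setU_disjoint (measurable_itv _)
  (measurable_itv _) D i1 i2.
split=> //.
by rewrite Rintegral_setU // e1 e2 big_ord_recr.
Qed.

Lemma Rintegral_support (A : set R) f : (forall x, ~ A x -> f x = 0) ->
  \int[mu]_x f x = \int[mu]_(x in A) f x.
Proof.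
move=> hf; rewrite [RHS]Rintegral_mkcond; apply: eq_Rintegral => x _.
by rewrite patchE; case: ifPn => // /negP; rewrite inE => /hf ->.
Qed.

End LebesguePolynomials.

(** * Exactness of the Gauss-Legendre rule *)

Section GaussLegendre.
Variable R : realType.
Implicit Types (f g : {poly R}) (G Q : seq (R * R)).

Lemma quad_is_linear Q : linear_for *%R (quad Q).
Proof.
move=> a f g; rewrite /quad mulr_sumr -big_split; apply: eq_bigr => q _ /=.
by rewrite hornerD hornerZ; ring.
Qed.
HB.instance Definition _ Q := GRing.isLinear.Build R {poly R} R *%R (quad Q)
  (quad_is_linear Q).

Lemma Rintegral01_horner f :
  \int[lebesgue_measure]_(x in `[0, 1]) f.[x] = int01 f.
Proof. by rewrite Rintegral_horner ?ltr01 // primitive0 subr0. Qed.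

Lemma root_derivn_exp (c : R) n k (V : {poly R}) : (k < n)%N ->
  root ((('X - c%:P) ^+ n * V)^`(k)) c.
Proof.
elim: k n V => [|k IH] [|n] V // hk.
  by rewrite derivn0 /root hornerM horner_exp hornerXsubC subrr expr0n /= mul0r.
rewrite derivSn.
have -> : (('X - c%:P) ^+ n.+1 * V)^`() =
   ('X - c%:P) ^+ n * (n.+1%:R * V + ('X - c%:P) * V^`()).
  rewrite derivM deriv_exp derivXsubC mul1r exprS /= -mulr_natl; ring.
exact: IH.
Qed.

(** Repeated integration by parts in Rodrigues' formula: the derivatives of order
    less than n of (X^2 - X)^n vanish at both end points. *)
Lemma legendre_orthogonal n f : (size f <= n)%N -> int01 (f * legendre n) = 0.
Proof.
move=> hf; rewrite /legendre -scalerAr linearZ /=.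
set W := ('X ^+ 2 - 'X) ^+ n.
have W01 k : (k < n)%N -> W^`(k).[0] = 0 /\ W^`(k).[1] = 0.
  move=> hk; split; apply/eqP; rewrite -/(root _ _).
    have -> : W = ('X - 0%:P) ^+ n * ('X - 1) ^+ n.
      by rewrite -exprMn subr0; congr (_ ^+ n); ring.
    exact: root_derivn_exp.
  have -> : W = ('X - 1%:P) ^+ n * 'X ^+ n.
    by rewrite -exprMn; congr (_ ^+ n); ring.
  exact: root_derivn_exp.
suff -> : int01 (f * W^`(n)) = 0 by rewrite mulr0.
have : (n <= n)%N by [].
elim: {-3}n f hf => [|k IH] f hf hk.
  by move: hf; rewrite leqn0 size_poly_eq0 => /eqP ->; rewrite mul0r linear0.
have -> : f * W^`(k.+1) = (f * W^`(k))^`() - f^`() * W^`(k).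
  by rewrite derivM -derivnS addrC addKr.
rewrite linearB /= int01_deriv !hornerM; have [-> ->] := W01 k hk.
rewrite !mulr0 subrr sub0r IH ?oppr0 ?(ltnW hk) //.
rewrite (leq_trans (size_poly _ _)) //; lia.
Qed.

Lemma size_legendre n : size (legendre n : {poly R}) = n.+1.
Proof.
have sW : size ((('X : {poly R}) ^+ 2 - 'X) ^+ n) = (2 * n).+1.
  have -> : ('X : {poly R}) ^+ 2 - 'X = ('X - 1%:P) * 'X by ring.
  have m1 : ('X - 1%:P) * 'X \is @monic R by rewrite monicMl ?monicX
    ?monicXsubC.
  have s1 : size (('X - 1%:P) * 'X : {poly R}) = 3%N.
    by rewrite size_mulX ?polyXsubC_eq0 // size_XsubC.
  elim: n => [|n IH]; first by rewrite expr0 size_poly1.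
  by rewrite exprS size_Mmonic ?monic_neq0 ?monic_exp // s1 IH /= mulnS.
rewrite /legendre size_scale ?invr_neq0 ?pnatr_eq0 -?lt0n ?fact_gt0 //.
apply/eqP; rewrite eqn_leq; apply/andP; split.
  apply/leq_sizeP => k hk; rewrite coef_derivn nth_default ?mul0rn // sW; lia.
rewrite ltnNge; apply/negP => /leq_sizeP /(_ n (leqnn n)).
rewrite coef_derivn => /eqP; rewrite mulrn_eq0 -[(_ ^_ _ == _)%N]negbK -lt0n
  ffact_gt0 leq_addr /=.
have -> : (n + n = (size ((('X : {poly R}) ^+ 2 - 'X) ^+ n)).-1)%N by rewrite
  sW /=; lia.
by rewrite -lead_coefE lead_coef_eq0 -size_poly_eq0 sW.
Qed.

(** Dividing by the Legendre polynomial: the multiple of it is orthogonal to the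
    quotient and vanishes at the nodes, and the remainder is integrated exactly
    because it equals its Lagrange interpolant. *)
Lemma gauss_legendre_exact n G f : gauss_legendre n G ->
  (size f <= 2 * n)%N -> quad G f = int01 f.
Proof.
move=> [sG uG rG wG] sf.
(* the cardinal polynomial of the node of q *)
pose L (q : R * R) : {poly R} := \prod_(r <- G | r.2 != q.2) ((q.2 - r.2)^-1 *:
  ('X - (r.2)%:P)).
have LE (q : R * R) x : (L q).[x] = \prod_(r <- G | r.2 != q.2) ((x - r.2) /
  (q.2 - r.2)).
  rewrite horner_prod; apply: eq_bigr => r _.
  by rewrite hornerZ hornerXsubC mulrC.
have w q : q \in G -> q.1 = int01 (L q).
  move=> hq; rewrite wG // -Rintegral01_horner.
  by apply: eq_Rintegral => x _; rewrite LE.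
have Lq (q : R * R) : (L q).[q.2] = 1.
  rewrite LE big1 // => r hr; rewrite divff // subr_eq0 eq_sym //.
have Lr (q r : R * R) : r \in G -> r.2 != q.2 -> (L q).[r.2] = 0.
  move=> hr hrq; rewrite LE; apply/eqP; rewrite prodf_seq_eq0; apply/hasP.
  by exists r => //; rewrite hrq subrr mul0r eqxx.
have inj2 (q r : R * R) : q \in G -> r \in G -> q.2 = r.2 -> q = r.
  move=> /(nthP 0)[i hi <-] /(nthP 0)[k hk <-].
  rewrite -!(nth_map 0 0 snd) // => e; congr (nth 0 G _).
  by move/(uniqP 0): uG => /(_ i k); rewrite !inE size_map; exact.
have sL q : q \in G -> (size (L q) <= n)%N.
  move=> hq; have cG : (count (fun r : R * R => r.2 == q.2) G +
     count (fun r : R * R => r.2 != q.2) G)%N = size G := count_predC _ _.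
  have c0 : (0 < count (fun r : R * R => r.2 == q.2) G)%N.
    by rewrite -has_count; apply/hasP; exists q.
  apply: (@leq_trans (count (fun r : R * R => r.2 != q.2) G).+1); last by lia.
  rewrite /L; elim: (G : seq (R * R)) => [|r s IH];
    first by rewrite big_nil size_poly1.
  rewrite big_cons /=; case: (r.2 != q.2) => //=.
  rewrite (leq_trans (size_polyMleq _ _)) //.
  have hs : (size ((q.2 - r.2)^-1 *: ('X - (r.2)%:P))%R <= 2)%N.
    by rewrite (leq_trans (size_scale_leq _ _)) // size_XsubC.
  by rewrite -subn1 leq_subLR (leq_trans (leq_add hs IH)).
have lagrange g : (size g <= n)%N -> g = \sum_(q <- G) g.[q.2] *: L q.
  move=> sg; apply/eqP; rewrite -subr_eq0; apply/eqP.
  apply: (@roots_geq_poly_eq0 _ _ [seq q.2 | q <- G]) => //.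
    apply/allP => _ /mapP[r hr ->]; apply/eqP;
      rewrite hornerD hornerN horner_sum.
    rewrite (bigD1_seq r) ?(map_uniq uG) //= hornerZ Lq mulr1 opprD addrA subrr
      sub0r.
    rewrite big_seq_cond big1 ?oppr0 // => q /andP[hq hqr].
    rewrite hornerZ Lr ?mulr0 //; apply: contra_neq hqr => e; exact/esym/inj2.
  rewrite size_map sG (leq_trans (size_polyD _ _)) // geq_max sg size_polyN.
  rewrite (leq_trans (size_sum _ _ _)) // big_seq;
    apply/bigmax_leqP_seq => q hq _.
  by rewrite (leq_trans (size_scale_leq _ _)) // sL.
have lagrange_exact g : (size g <= n)%N -> quad G g = int01 g.
  move=> sg; rewrite {2}(lagrange g sg) raddf_sum /quad big_seq [RHS]big_seq.
  by apply: eq_bigr => q hq; rewrite /= linearZ /= w // mulrC.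
have L0 : legendre n != 0 :> {poly R} by rewrite -size_poly_eq0 size_legendre.
rewrite (divp_eq f (legendre n)) !linearD /= legendre_orthogonal; last first.
  by rewrite size_divp // size_legendre /= leq_subLR addnn -mul2n.
rewrite [X in _ + X]lagrange_exact; last first.
  by rewrite -ltnS -(size_legendre n) ltn_modp.
congr (_ + _); rewrite /quad big_seq big1 // => q hq.
by rewrite hornerM (rootP (rG q hq)) !mulr0.
Qed.

End GaussLegendre.

(** * From splines on the grid to the reference polynomials *)

Section Elements.
Variable R : realType.
Variables (h : R) (h0 : 0 < h).
Implicit Types (f : R -> R) (g : {poly R}) (i j k : int) (p : nat) (x : R).
Local Notation piece := (@piece R).
Local Notation knot := (@knot R).

Lemma knotD i j : knot h (i + j) = knot h i + j%:~R * h.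
Proof. by rewrite /Defs.knot intrD mulrDl. Qed.

Lemma le_knot i j : (knot h i <= knot h j) = (i <= j).
Proof. by rewrite /Defs.knot ler_pM2r // ler_int. Qed.

Lemma lt_knot i j : (knot h i < knot h j) = (i < j).
Proof. by rewrite /Defs.knot ltr_pM2r // ltr_int. Qed.

Lemma element_exists j x : exists i, knot h (j + i) <= x < knot h (j + i + 1).
Proof.
exists (Num.floor (x / h) - j).
have -> : j + (Num.floor (x / h) - j) = Num.floor (x / h) by rewrite addrC
  subrK.
rewrite /Defs.knot -ler_pdivlMr // -ltr_pdivrMr //.
by rewrite floor_le_tmp /= floorD1_gt.
Qed.

Lemma bspline_piece p j i x : knot h (j + i) <= x < knot h (j + i + 1) ->
  bspline h p j x = (piece p i).[(x - knot h (j + i)) / h].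
Proof.
elim: p j i => [|p IH] j i hx.
  rewrite /= horner_natr; move: hx => /andP[h1 h2].
  have [i0|i0] := eqVneq i 0.
    by move: h1 h2; rewrite i0 addr0 => -> ->.
  case: ifP => // /andP[h3 h4]; exfalso.
  have := le_lt_trans h1 h4; have := le_lt_trans h3 h2.
  rewrite !lt_knot; move: i0; lia.
rewrite /= (IH j i) // (IH (j + 1) (i - 1)); last first.
  by have -> : j + 1 + (i - 1) = j + i by lia.
have -> : j + 1 + (i - 1) = j + i by lia.
set u := (piece p i).[_]; set v := (piece p (i - 1)).[_].
rewrite !(horner_natr, horner_intr, hornerZ, hornerM, hornerN, hornerX,
  hornerD) -/u -/v.
have hp : p.+1%:R != 0 :> R by rewrite pnatr_eq0.
have hh : h != 0 by rewrite gt_eqF.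
rewrite !knotD -[p.+2%:R]natr1 -!pmulrn.
move: (p.+1%:R) hp => P hp.
have d1 : knot h j + P * h - knot h j = P * h by ring.
have d2 : knot h j + P * h + 1 * h - (knot h j + 1 * h) = P * h by ring.
rewrite d1 d2; field.
by rewrite hh hp.
Qed.

(** The affine map from the element with index j onto [0, 1]. *)
Definition elt_coord j : {poly R} := h^-1 *: ('X - (knot h j)%:P).

Lemma horner_elt_coord g j x : (g \Po elt_coord j).[x] = g.[(x - knot h j) / h].
Proof. by rewrite horner_comp hornerZ hornerXsubC mulrC. Qed.

Lemma poly_eq_itv (a b : R) g1 g2 : a < b ->
  (forall x, a < x < b -> g1.[x] = g2.[x]) -> g1 = g2.
Proof.
move=> ab e; apply/eqP; rewrite -subr_eq0; apply/eqP.
(* pairwise distinct points of ]a, b[, as many as the size of g1 - g2 *)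
pose c (k : nat) := a + (b - a) / k.+2%:R.
apply: (@roots_geq_poly_eq0 _ _ (map c (iota 0 (size (g1 - g2)%R)))).
- apply/allP => _ /mapP[k _ ->]; rewrite /root hornerD hornerN e ?subrr //.
  have k0 : 0 < k.+2%:R :> R by rewrite ltr0n.
  have k1 : 1 < k.+2%:R :> R by rewrite ltr1n.
  rewrite /c ltrDl divr_gt0 ?subr_gt0 //= -ltrBrDl ltr_pdivrMr //.
  by rewrite ltr_pMr ?subr_gt0.
- rewrite map_inj_uniq ?iota_uniq // => k l /addrI.
  have ab0 : b - a != 0 by rewrite gt_eqF // subr_gt0.
  move/(mulfI ab0)/invr_inj/eqP; rewrite eqr_nat => /eqP. by case.
- by rewrite size_map size_iota.
Qed.

Lemma knot_lt i : knot h i < knot h (i + 1).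
Proof. by rewrite lt_knot; lia. Qed.

Lemma element_polyE i f g :
  (forall x, knot h i < x < knot h (i + 1) -> f x = g.[x]) ->
  element_poly h i f = g.
Proof.
move=> fg; rewrite /element_poly.
have := @xgetPex _ 0 [set g : {poly R} |
          forall x, knot h i < x < knot h (i + 1) -> f x = g.[x]].
set g' := xget _ _ => /(_ (ex_intro _ g fg)) /= hg'.
by apply: (poly_eq_itv (knot_lt i)) => x hx; rewrite -hg' // fg.
Qed.

(** The two functionals of the problem, on an integrand that on each element is
    a polynomial [w i] of the local coordinate. *)
Section Piecewise.
Variables (f : R -> R) (w : int -> {poly R}) (p : nat) (j : int).
Hypothesis f_elt : forall i x, knot h (j + i) < x < knot h (j + i + 1) ->
  f x = (w i).[(x - knot h (j + i)) / h].
Hypothesis w_out : forall i, ~~ (0 <= i <= p%:Z) -> w i = 0.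

Lemma composite_piecewise (I : {poly R} -> R) :
  I 0 = 0 -> composite I h f = h * \sum_(i < p.+1) I (w i%:Z).
Proof.
move=> I0.
have elt i : element_poly h (j + i) f \Po ((knot h (j + i))%:P + h *: 'X) = w i.
  rewrite (@element_polyE _ _ (w i \Po elt_coord (j + i))); last first.
    by move=> x hx; rewrite horner_elt_coord (f_elt hx).
  rewrite -comp_polyA /elt_coord comp_polyZ comp_polyB comp_polyX comp_polyC.
  by rewrite addrC addKr scalerA mulVf ?gt_eqF // scale1r comp_polyXr.
pose r := [seq j + n%:Z | n <- iota 0 p.+1].
rewrite /composite (fsbigE r) //.
- rewrite big_map mulr_sumr -/(index_iota 0 p.+1) big_mkord.
  by apply: eq_big => i; rewrite ?in_setT // => _; rewrite elt.
- by rewrite map_inj_uniq ?iota_uniq // => x y; lia.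
- move=> i _ hi; have -> : i = j + (i - j) by lia.
  rewrite elt w_out ?I0 ?mulr0 //; apply: contra hi => hi.
  apply/mapP; exists (absz (i - j)); last by lia.
  by rewrite mem_iota; lia.
Qed.

Hypothesis f_out : forall x, ~~ (knot h j <= x <= knot h (j + p.+1%:Z)) -> f x
  = 0.

(** The summation runs over one element more than the support, since the value
    of [f] at the last knot of the support is arbitrary. *)
Lemma Rintegral_piecewise :
  \int[lebesgue_measure]_x f x = h * int01 (\sum_(i < p.+1) w i%:Z).
Proof.
pose a (i : nat) := knot h (j + i%:Z).
pose g (i : nat) := w i%:Z \Po elt_coord (j + i%:Z).
have aS (i : nat) : a i.+1 = knot h (j + i%:Z + 1).
  by rewrite /a -addn1 PoszD addrA.
have ha (i : nat) : a i < a i.+1 by rewrite aS knot_lt.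
have fg (i : nat) x : (i < p.+2)%N -> a i < x < a i.+1 -> f x = (g i).[x].
  by move=> _; rewrite aS => hx; rewrite /g horner_elt_coord (f_elt hx).
have [_ e] := Rintegral_elements ha fg.
rewrite (@Rintegral_support _ (`[a 0%N, a p.+2[)); last first.
  move=> x hx; apply: f_out; apply/negP => /andP[h1 h2]; apply: hx.
  rewrite /= in_itv /= /a addr0 h1 /= (le_lt_trans h2) // lt_knot.
  by lia.
have gp : g p.+1 = 0 by rewrite /g w_out ?comp_poly0 //; lia.
rewrite e big_ord_recr /= gp linear0 !horner0 subrr addr0.
rewrite linear_sum mulr_sumr; apply: eq_bigr => i _ /=.
have hh : h != 0 by rewrite gt_eqF.
have -> : g i = (h *: (primitive (w i%:Z) \Po elt_coord (j + i%:Z)))^`().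
  rewrite derivZ deriv_comp deriv_primitive /elt_coord derivZ derivXsubC.
  by rewrite -scalerAr mulr1 scalerA divff // scale1r.
rewrite primitive_deriv !hornerD !hornerN !hornerC opprD addrACA subrr addr0.
rewrite !hornerZ -mulrBr !horner_elt_coord; congr (_ * _).
rewrite subrr mul0r primitive0 subr0 aS knotD mul1r addrC addKr divff //.
Qed.

End Piecewise.
End Elements.

(** * The matrix entries *)

Lemma blend_is_linear (R : realType) (t : R) (I J : {scalar {poly R}}) :
  linear_for *%R (blend t I J).
Proof. by move=> a f g; rewrite /blend !linearP; ring. Qed.
HB.instance Definition _ (R : realType) (t : R) (I J : {scalar {poly R}}) :=
  GRing.isLinear.Build R {poly R} R *%R (blend t I J) (blend_is_linear t I J).

Section Entries.
Variable R : realType.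
Variables (h : R) (h0 : 0 < h).
Implicit Types (i j k : int) (p : nat) (x : R) (I : {scalar {poly R}}).
Local Notation piece := (@piece R).
Local Notation knot := (@knot R).

Lemma bspline_out p j x :
  ~~ (knot h j <= x < knot h (j + p.+1%:Z)) -> bspline h p j x = 0.
Proof.
move=> hx; have [i hi] := element_exists h0 j x.
rewrite (bspline_piece h0 p hi) piece_out ?horner0 //.
apply: contra hx => /andP[i0 ip]; case/andP: hi => h1 h2.
rewrite (le_trans _ h1) ?(lt_le_trans h2) // le_knot //; lia.
Qed.

Lemma derive_bspline p j i x : knot h (j + i) < x < knot h (j + i + 1) ->
  (bspline h p j)^`()%classic x =
  h^-1 * (piece p i)^`().[(x - knot h (j + i)) / h].
Proof.
move=> /andP[h1 h2].
rewrite derive1E (@near_eq_derive _ _ _ _ (horner (piece p i \Po elt_coord h (j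
  + i)))); last first.
  have := near_in_itvoo (_ : x \in `]knot h (j + i), knot h (j + i + 1)[).
  rewrite in_itv /= h1 h2 => /(_ isT).
  apply: filterS => y; rewrite in_itv /= => /andP[y1 y2].
  by rewrite horner_elt_coord (bspline_piece h0 p (i := i)) // (ltW y1) y2.
rewrite derive_val deriv_comp hornerM horner_elt_coord mulrC.
by rewrite /elt_coord derivZ derivXsubC hornerZ hornerC mulr1.
Qed.

(** At both end knots the spline may have a kink, when p = 1. *)
Lemma derive_bspline_out p j x :
  ~~ (knot h j <= x <= knot h (j + p.+1%:Z)) -> (bspline h p j)^`()%classic x =
    0.
Proof.
move=> hx; rewrite derive1E (@near_eq_derive _ _ _ _ (cst 0)) ?derive_cst //.
have : x < knot h j \/ knot h (j + p.+1%:Z) < x.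
  by move: hx; rewrite negb_and -!ltNge => /orP.
case=> hlt.
  apply: filterS (lt_nbhsl hlt) => y hy; apply: bspline_out.
  by rewrite negb_and -ltNge hy.
apply: filterS (lt_nbhsr hlt) => y hy; apply: bspline_out.
by rewrite negb_and -leNgt orbC ltW.
Qed.

Lemma mass_integrand_element p j k i x :
  knot h (j + i) < x < knot h (j + i + 1) ->
  mass_integrand h p j k x =
  (piece p i * piece p (i - k)).[(x - knot h (j + i)) / h].
Proof.
move=> /andP[h1 h2].
have hx : knot h (j + i) <= x < knot h (j + i + 1) by rewrite ltW.
have e : j + k + (i - k) = j + i by lia.
have hx' : knot h (j + k + (i - k)) <= x < knot h (j + k + (i - k) + 1) by
  rewrite e.
by rewrite /mass_integrand hornerM (bspline_piece h0 p hx) (bspline_piece h0 p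
  hx') e.
Qed.

Lemma stiffness_integrand_element p j k i x :
  knot h (j + i) < x < knot h (j + i + 1) ->
  stiffness_integrand h p j k x =
  ((h ^+ 2)^-1 *: ((piece p i)^`() * (piece p (i - k))^`())).[
    (x - knot h (j + i)) / h].
Proof.
move=> hx; have e : j + k + (i - k) = j + i by lia.
have hx' : knot h (j + k + (i - k)) < x < knot h (j + k + (i - k) + 1) by
  rewrite e.
rewrite /stiffness_integrand hornerZ hornerM (derive_bspline p hx)
  (derive_bspline p hx') e.
by rewrite -exprVn; ring.
Qed.

Lemma mass_quadE I p j k : mass_quad I h p j k = I (mass_poly R p k).
Proof.
rewrite /mass_quad (@composite_piecewise _ _ h0 _
  (fun i => piece p i * piece p (i - k)) p j).
- by rewrite mulrA mulVf ?gt_eqF // mul1r -raddf_sum.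
- by move=> i x; exact: mass_integrand_element.
- by move=> i hi; rewrite piece_out // mul0r.
- exact: linear0.
Qed.

Lemma massE p j k : mass h p j k = int01 (mass_poly R p k).
Proof.
rewrite /mass (@Rintegral_piecewise _ _ h0 _
  (fun i => piece p i * piece p (i - k)) p j).
- by rewrite mulrA mulVf ?gt_eqF // mul1r.
- by move=> i x; exact: mass_integrand_element.
- by move=> i hi; rewrite piece_out // mul0r.
- move=> x hx; rewrite /mass_integrand bspline_out ?mul0r //.
  by apply: contra hx => /andP[-> /ltW ->].
Qed.

Let sum_scale p k :
  \sum_(i < p.+1)
    ((h ^+ 2)^-1 *: ((piece p i%:Z)^`() * (piece p (i%:Z - k))^`())) =
  (h ^+ 2)^-1 *: stiff_poly R p k.
Proof. by rewrite /stiff_poly /autocorr scaler_sumr. Qed.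

Lemma stiffness_quadE I p j k : stiffness_quad I h p j k = I (stiff_poly R p k).
Proof.
rewrite /stiffness_quad (@composite_piecewise _ _ h0 _
  (fun i => (h ^+ 2)^-1 *: ((piece p i)^`() * (piece p (i - k))^`())) p j).
- rewrite -raddf_sum /= sum_scale linearZ /= !mulrA -expr2 mulfV ?mul1r //.
  by rewrite expf_eq0 /= gt_eqF.
- by move=> i x; exact: stiffness_integrand_element.
- by move=> i hi; rewrite piece_deriv_out // mul0r scaler0.
- exact: linear0.
Qed.

Lemma stiffnessE p j k : stiffness h p j k = int01 (stiff_poly R p k).
Proof.
rewrite /stiffness (@Rintegral_piecewise _ _ h0 _
  (fun i => (h ^+ 2)^-1 *: ((piece p i)^`() * (piece p (i - k))^`())) p j).
- rewrite sum_scale linearZ /= !mulrA -expr2 mulfV ?mul1r //.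
  by rewrite expf_eq0 /= gt_eqF.
- by move=> i x; exact: stiffness_integrand_element.
- by move=> i hi; rewrite piece_deriv_out // mul0r scaler0.
- by move=> x hx; rewrite /stiffness_integrand derive_bspline_out ?mul0r.
Qed.

End Entries.

(** * Taylor expansion of the symbols *)

Section CosineExpansion.
Variable R : realType.
Implicit Types (x t : R) (n m p : nat).

Definition cos_taylor n : {poly R} :=
  \sum_(m < n) ((-1) ^+ m / (2 * m)`!%:R) *: 'X^(2 * m).

Definition sin_taylor n : {poly R} :=
  \sum_(m < n) ((-1) ^+ m / (2 * m).+1`!%:R) *: 'X^((2 * m).+1).

Lemma deriv_divided_power (c : R) n :
  ((c / n.+1`!%:R) *: 'X^(n.+1))^`() = (c / n`!%:R) *: 'X^n.
Proof.
rewrite derivZ derivXn /= -scalerMnr scalerMnl; congr (_ *: _).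
rewrite factS natrM -mulr_natr; field.
by rewrite nat1r !pnatr_eq0 -lt0n fact_gt0.
Qed.

Lemma deriv_sin_taylor n : (sin_taylor n)^`() = cos_taylor n.
Proof.
by rewrite raddf_sum; apply: eq_bigr => m _; rewrite /= deriv_divided_power.
Qed.

Lemma deriv_cos_taylor n : (cos_taylor n.+1)^`() = - sin_taylor n.
Proof.
rewrite /cos_taylor big_ord_recl derivD muln0 derivZ derivC scaler0 add0r.
rewrite raddf_sum -sumrN; apply: eq_bigr => m _.
rewrite lift0 /= mulnS add2n deriv_divided_power.
by rewrite exprS mulN1r mulNr scaleNr.
Qed.

Lemma abs_le_pow_of_derive (f df : R -> R) n x :
  (forall y, is_derive y (1 : R) f (df y)) -> f 0 = 0 ->
  (forall y, `|df y| <= `|y| ^+ n) -> `|f x| <= `|x| ^+ n.+1.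
Proof.
move=> fd f0 hd.
have cf (a b : R) : {within `[a, b], continuous f}.
  apply: continuous_subspaceT => y.
  by have [dfy _] := fd y; exact/differentiable_continuous/derivable1_diffP.
have [c hc e] : exists2 c, `|c| <= `|x| & f x = df c * x.
  have [x0|x0] := leP 0 x.
    have [c hc] := @MVT_segment R f df 0 x x0 (fun y _ => fd y) (cf 0 x).
    rewrite f0 !subr0 => e; exists c => //.
    by move: hc; rewrite in_itv /= => /andP[c0 cx]; rewrite !ger0_norm.
  have [c hc] := @MVT_segment R f df x 0 (ltW x0) (fun y _ => fd y) (cf x 0).
  rewrite f0 !sub0r mulrN => /oppr_inj e; exists c => //.
  by move: hc; rewrite in_itv /= => /andP[c0 cx];
    rewrite ler0_norm // ltr0_norm // lerN2.
rewrite e normrM exprSr ler_wpM2r // (le_trans (hd c)) //.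
by rewrite lerXn2r ?nnegrE.
Qed.

(** Induction from the mean value theorem, cosine and sine in turn; the constant 1
    instead of an inverse factorial is enough here. *)
Lemma cos_sin_taylor_bound n x :
  `|cos x - (cos_taylor n).[x]| <= `|x| ^+ (2 * n) /\
  `|sin x - (sin_taylor n).[x]| <= `|x| ^+ (2 * n).+1.
Proof.
have sinb k : (forall y, `|cos y - (cos_taylor k).[y]| <= `|y| ^+ (2 * k)) ->
    forall y, `|sin y - (sin_taylor k).[y]| <= `|y| ^+ (2 * k).+1.
  move=> hk y.
  apply: (@abs_le_pow_of_derive (fun y => sin y - (sin_taylor k).[y])
    (fun y => cos y - (cos_taylor k).[y])) => //.
    by move=> z; apply: is_derive_eq; rewrite deriv_sin_taylor.
  rewrite sin0 sub0r /sin_taylor horner_sum big1 ?oppr0 // => m _.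
  by rewrite hornerZ hornerXn expr0n mulr0.
have cosb : forall y, `|cos y - (cos_taylor n).[y]| <= `|y| ^+ (2 * n).
  elim: n => [|n IH] y.
    by rewrite /cos_taylor big_ord0 horner0 subr0 muln0 expr0 ler_norml
      cos_geN1 cos_le1.
  rewrite mulnS add2n.
  apply: (@abs_le_pow_of_derive (fun y => cos y - (cos_taylor n.+1).[y])
    (fun y => - (sin y - (sin_taylor n).[y]))).
  - by move=> z; apply: is_derive_eq;
    rewrite deriv_cos_taylor hornerN opprB opprK addrC.
  - rewrite cos0 /cos_taylor horner_sum big_ord_recl muln0 expr0 fact0 divr1
    scale1r hornerC.
    rewrite big1 ?addr0 ?subrr // => m _.
    by rewrite hornerZ hornerXn expr0n mulr0.
  - by move=> z; rewrite normrN; apply: sinb.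
by split; [exact: cosb | exact: sinb].
Qed.

Definition symbol p (a : nat -> R) t : R :=
  a 0%N + 2 * \sum_(1 <= k < p.+1) a k * cos (k%:R * t).

Lemma symbol_expansion p (a : nat -> R) n :
  exists2 K : R, 0 <= K & forall t,
  `|symbol p a t - \sum_(m < n.+1) (-1) ^+ m * sym_moment p a m * t ^+ (2 * m)|
  <= K * t ^+ (2 * n.+1).
Proof.
exists (2 * \sum_(1 <= k < p.+1) `|a k| * k%:R ^+ (2 * n.+1)).
  by rewrite mulr_ge0 // sumr_ge0 // => k _; rewrite mulr_ge0 // exprn_ge0.
move=> t.
have -> : \sum_(m < n.+1) (-1) ^+ m * sym_moment p a m * t ^+ (2 * m)
   = a 0%N + 2 * \sum_(1 <= k < p.+1) a k * (cos_taylor n.+1).[k%:R * t].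
  under eq_bigr do rewrite /sym_moment mulrDr mulrDl.
  rewrite big_split /=; congr (_ + _).
    rewrite big_ord_recl big1 ?addr0 ?muln0 ?expr0 ?mulr1 ?mul1r // => m _.
    by rewrite /= mul0r mulr0 mul0r.
  under [in RHS]eq_bigr do rewrite /cos_taylor horner_sum mulr_sumr.
  rewrite exchange_big mulr_sumr; apply: eq_bigr => m _ /=.
  rewrite mulrCA -!mulrA mulr_suml mulr_sumr; congr (_ * _);
    apply: eq_bigr => k _.
  by rewrite hornerZ hornerXn exprMn; ring.
rewrite /symbol opprD addrACA subrr add0r -mulrBr -sumrB.
under eq_bigr do rewrite -mulrBr.
rewrite normrM ger0_norm // -mulrA ler_wpM2l // (le_trans (ler_norm_sum _ _ _))
  //.
rewrite mulr_suml; apply: ler_sum => k _.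
rewrite normrM -mulrA ler_wpM2l //.
have [h _] := cos_sin_taylor_bound n.+1 (k%:R * t); apply: le_trans h _.
rewrite normrM exprMn ger0_norm // ler_wpM2l ?exprn_ge0 //.
by rewrite !exprM real_normK ?num_real.
Qed.

(** With X the term of order 2p + 4, r = a - t^2 b - X and b = 1 + d, one has
    a / b - t^2 - X = (r - X d) / b, where r and X d are O(t^(2p+6)) and b >= 1/2
    for small t. *)
Lemma eigenvalue_expansion p (a b : nat -> R) (mu : R) :
  sym_moment p a 0 = 0 -> sym_moment p b 0 = 1 ->
  (forall m, (m <= p)%N -> sym_moment p a m.+1 + sym_moment p b m = 0) ->
  exists K, \forall h \near (0 : R)^'+,
  `|(h ^+ 2)^-1 * (symbol p a (mu * h) / symbol p b (mu * h)) - mu ^+ 2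
    - (-1) ^+ p * (sym_moment p a p.+2 + sym_moment p b p.+1)
      * mu ^+ (2 * p + 4) * h ^+ (2 * p + 2)| <= K * h ^+ (2 * p + 4).
Proof.
have e4 : (2 * p.+2 = 2 + (2 * p + 2))%N by lia.
have e4' : (2 * p.+2 = 2 * p + 4)%N by lia.
have e6 : (2 * p.+3 = 2 * p + 4 + 2)%N by lia.
move=> a0 b0 ab.
have [Ka Ka0 hKa] := symbol_expansion p a p.+2.
have [Kb Kb0 hKb] := symbol_expansion p b p.+1.
have [K K0 hK] := symbol_expansion p b 0.
set C := sym_moment p a p.+2 + sym_moment p b p.+1.
pose X t := (-1) ^+ p * C * t ^+ (2 * p.+2).
have polyE t : \sum_(m < p.+3) (-1) ^+ m * sym_moment p a m * t ^+ (2 * m)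
   - t ^+ 2 * \sum_(m < p.+2) (-1) ^+ m * sym_moment p b m * t ^+ (2 * m) = X t.
  rewrite big_ord_recl a0 mulr0 mul0r add0r mulr_sumr -sumrB.
  rewrite (eq_bigr (fun m : 'I_p.+2 => (-1) ^+ m.+1 *
    (sym_moment p a m.+1 + sym_moment p b m) * t ^+ (2 * m.+1))); last first.
    move=> m _; rewrite lift0 mulnS exprD exprS;
      move: (t ^+ (2 * m)) ((-1) ^+ m) => u s; ring.
  rewrite big_ord_recr /= big1 ?add0r; last by move=> m _;
    rewrite ab ?mulr0 ?mul0r // -ltnS.
  by rewrite /X [(-1) ^+ p.+2]exprS [(-1) ^+ p.+1]exprS !mulN1r opprK.
have bnd t : `|symbol p a t - t ^+ 2 * symbol p b t - X t| <= (Ka + Kb) * t ^+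
  (2 * p.+3).
  rewrite -polyE.
  have -> : forall A B U V : R, A - t ^+ 2 * B - (U - t ^+ 2 * V) = (A - U) - t
    ^+ 2 * (B - V).
    by move=> *; ring.
  rewrite (le_trans (ler_normB _ _)) // mulrDl lerD // normrM ger0_norm
    ?sqr_ge0 //.
  by rewrite [(2 * p.+3)%N]mulnS exprD mulrCA ler_wpM2l ?sqr_ge0.
have bnd1 t : `|symbol p b t - 1| <= K * t ^+ 2.
  by have := hK t; rewrite big_ord_recr big_ord0 /= add0r b0 !mulr1.
pose M := K * mu ^+ 2.
have M0 : 0 <= M by rewrite mulr_ge0 ?sqr_ge0.
exists (2 * (Ka + Kb + `|C| * K) * mu ^+ (2 * p.+3)).
near=> h.
have h0 : 0 < h by near: h; exact: nbhs_right_gt.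
have h1 : h < 1 by near: h; exact: nbhs_right_lt.
(* for such h, |b - 1| <= K t^2 <= 1/2 *)
have hM : h < (2 * (M + 1))^-1.
  by near: h; apply: nbhs_right_lt; rewrite invr_gt0 mulr_gt0 // ltr_wpDl.
set t := mu * h.
have t2 : K * t ^+ 2 <= 2^-1.
  have -> : K * t ^+ 2 = M * h * h by rewrite /M /t; ring.
  have hM1 : h * (2 * (M + 1)) < 1.
    by rewrite -ltr_pdivlMr ?div1r // mulr_gt0 // ltr_wpDl.
  have : M * h * h <= M * h by rewrite ler_piMr ?(mulr_ge0 M0 (ltW h0)) ?(ltW
    h1).
  by rewrite -[2^-1]/(2^-1 : R); lra.
have hb : 2^-1 <= symbol p b t.
  have := bnd1 t; rewrite ler_norml => /andP[+ _]; lra.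
have b_gt0 : 0 < symbol p b t by apply: lt_le_trans hb; rewrite invr_gt0.
have hh : h != 0 by rewrite gt_eqF.
have bn0 : symbol p b t != 0 by rewrite gt_eqF.
set A := symbol p a t in bnd *; set B := symbol p b t in bnd1 hb b_gt0 bn0 *.
have tE n : t ^+ n = mu ^+ n * h ^+ n by exact: exprMn.
have h4E : h ^+ (2 * p.+2) = h ^+ 2 * h ^+ (2 * p + 2).
  by rewrite -exprD -e4.
have h6E : h ^+ (2 * p.+3) = h ^+ (2 * p + 4) * h ^+ 2.
  by rewrite -exprD -e6.
have mu4E : mu ^+ (2 * p.+2) = mu ^+ (2 * p + 4).
  by rewrite e4'.
have XE : X t = h ^+ 2 * ((-1) ^+ p * C * mu ^+ (2 * p + 4) * h ^+ (2 * p + 2)).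
  rewrite /X tE h4E mu4E.
  move: (h ^+ 2) (h ^+ (2 * p + 2)) (mu ^+ (2 * p + 4)) ((-1) ^+ p * C) => u v
    w s.
  by ring.
have -> : (h ^+ 2)^-1 * (A / B) - mu ^+ 2 - (-1) ^+ p * C * mu ^+ (2 * p + 4) *
  h ^+ (2 * p + 2)
   = (h ^+ 2)^-1 * ((A - t ^+ 2 * B - X t) - X t * (B - 1)) / B.
  have -> : A - t ^+ 2 * B - X t - X t * (B - 1) = A - t ^+ 2 * B - X t * B by
    ring.
  rewrite XE /t; move: ((-1) ^+ p * C * mu ^+ (2 * p + 4) * h ^+ (2 * p + 2))
    => Y.
  by field; rewrite bn0 hh.
rewrite !normrM !normfV (ger0_norm (sqr_ge0 h)) (ger0_norm (ltW b_gt0)).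
rewrite ler_pdivrMr // mulrC ler_pdivrMr ?exprn_gt0 //.
apply: le_trans (_ : (Ka + Kb + `|C| * K) * t ^+ (2 * p.+3) <= _).
  rewrite (le_trans (ler_normB _ _)) // [in leRHS]mulrDl lerD ?bnd //.
  have T0 : 0 <= t ^+ (2 * p.+2) by rewrite exprM exprn_ge0 ?sqr_ge0.
  have -> : `|X t * (B - 1)| = `|C| * t ^+ (2 * p.+2) * `|B - 1|.
    rewrite /X; move: (t ^+ (2 * p.+2)) T0 => T T0.
    by rewrite !normrM (ger0_norm T0) normrX normrN1 expr1n mul1r.
  have -> : t ^+ (2 * p.+3) = t ^+ 2 * t ^+ (2 * p.+2) by rewrite -exprD -mulnS.
  move: (t ^+ (2 * p.+2)) T0 => T T0.
  have -> : `|C| * K * (t ^+ 2 * T) = `|C| * T * (K * t ^+ 2) by ring.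
  by apply: ler_wpM2l (bnd1 t); rewrite mulr_ge0.
have W0 : 0 <= (Ka + Kb + `|C| * K) * t ^+ (2 * p.+3).
  apply: mulr_ge0; last by rewrite exprM exprn_ge0 ?sqr_ge0.
  by apply: addr_ge0; [exact: addr_ge0 | exact: mulr_ge0].
have -> : 2 * (Ka + Kb + `|C| * K) * mu ^+ (2 * p.+3) * h ^+ (2 * p + 4) * B *
  h ^+ 2
  = (Ka + Kb + `|C| * K) * t ^+ (2 * p.+3) * (2 * B).
  rewrite tE h6E.
  by move: (h ^+ (2 * p + 4)) (mu ^+ _) (h ^+ 2) => u v w; ring.
by rewrite ler_peMr //; lra.
Unshelve. all: by end_near.
Qed.

End CosineExpansion.

(** * The blended rule *)

Section BlendedMoments.
Variable R : numFieldType.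

Lemma sym_moment_blend p (t : R) (b q : nat -> R) m :
  sym_moment p (fun k => t * b k + (1 - t) * q k) m =
  t * sym_moment p b m + (1 - t) * sym_moment p q m.
Proof.
rewrite /sym_moment !mulrDr addrACA; congr (_ + _); first by ring.
rewrite !mulr_sumr -big_split; apply: eq_bigr => k _ /=; ring.
Qed.

Lemma sym_momentS p (a : nat -> R) m :
  sym_moment p a m.+1 =
  2 * \sum_(1 <= k < p.+1) k%:R ^+ (2 * m + 2) / (2 * m + 2)`!%:R * a k.
Proof. by rewrite /sym_moment mul0r add0r mulnS addnC. Qed.

End BlendedMoments.

Lemma mass_error_neq0 (R : realType) p (I : {scalar {poly R}}) :
  (0 < p)%N -> (forall f : {poly R}, (size f <= 2 * p - 1)%N -> I f = int01 f)
    ->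
  ~ mass_exact p I -> I (bump_poly R p) - int01 (bump_poly R p) != 0.
Proof.
move=> hp hI; apply: contra_not_neq => e0 h j k h0.
rewrite (mass_quadE h0) (massE h0); apply/eqP; rewrite -subr_eq0.
rewrite (sym_poly_error hp hI (size_mass_poly R p k) (mass_poly_reflect R p k)).
by rewrite e0 mulr0.
Qed.

Theorem theorem4 (R : realType) (p : nat) (mu : R) (j : int)
    (G Q : seq (R * R))
    (hp : (1 <= p)%N) (hmu : mu != 0)
    (hG : gauss_legendre p.+1 G)
    (hnodes : forall q : R * R, q \in Q -> 0 <= q.2 <= 1)
    (hQG : quad Q <> quad G)
    (hQexact : exact_up_to (2 * p - 2) Q)
    (hQmass : ~ mass_exact p (quad Q))
    (hQopt : ~ optimal p (quad Q)) :
  (fun h : R =>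
     approx_eigenvalue (blend (tau (quad Q) h p j) (quad G) (quad Q)) h p j mu
     - mu ^+ 2)
  = (fun h : R =>
       2 * (-1) ^+ p *
       (\sum_(1 <= k < p.+1)
          (k%:R ^+ (2 * p + 4) / (2 * p + 4)`!%:R * stiffness h p j k
           + k%:R ^+ (2 * p + 2) / (2 * p + 2)`!%:R
             * (tau (quad Q) h p j * mass h p j k
                + (1 - tau (quad Q) h p j) * mass_quad (quad Q) h p j k)))
       * mu ^+ (2 * p + 4) * h ^+ (2 * p + 2))
    +O_ ((0 : R)^'+) (fun h : R => h ^+ (2 * p + 4)).
Proof.
have Q_exact (f : {poly R}) : (size f <= 2 * p - 1)%N -> quad Q f = int01 f.
  move=> sf; rewrite hQexact ?Rintegral01_horner // (leq_trans sf) //; lia.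
have G_mass k : quad G (mass_poly R p k) = int01 (mass_poly R p k).
  apply: gauss_legendre_exact hG _; apply: leq_trans (size_mass_poly _ _ _) _;
    lia.
have Q_stiff k : quad Q (stiff_poly R p k) = int01 (stiff_poly R p k).
  by apply: Q_exact; apply: leq_trans (size_stiff_poly _ _ hp) _; lia.
pose a (k : nat) := int01 (stiff_poly R p k).
pose b (k : nat) := int01 (mass_poly R p k).
pose q (k : nat) := quad Q (mass_poly R p k).
pose s := tau (quad Q) 1 p j.
have tauE h : 0 < h -> tau (quad Q) h p j =
  (sym_moment p a p.+1 + sym_moment p q p) / (sym_moment p q p - sym_moment p b
    p).
  move=> h0; rewrite sym_momentS.
  have p0 : (p == 0%N) = false by lia.
  rewrite /sym_moment p0 !mul0r !add0r -mulrDr -mulrBr -mulf_div divff ?mul1r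
    ?pnatr_eq0 //.
  rewrite -big_split -sumrB /tau; congr (_ / _); apply: eq_bigr => k _ /=.
    by rewrite stiffness_quadE // mass_quadE // /= Q_stiff.
  by rewrite mass_quadE // massE // mulrBr.
have e0 := mass_error_neq0 hp Q_exact hQmass.
have D0 : sym_moment p q p - sym_moment p b p != 0.
  rewrite (mass_moment_error hp Q_exact (leqnn p)) eqxx mul1r;
    apply: mulf_neq0 e0; apply: mulf_neq0.
    by rewrite pnatr_eq0 -lt0n bin_gt0; lia.
  by rewrite invr_eq0 pnatr_eq0 -lt0n fact_gt0.
have qb m : (m < p)%N -> sym_moment p q m = sym_moment p b m.
  move=> hm; apply/eqP; rewrite -subr_eq0.
  by rewrite (mass_moment_error hp Q_exact (ltnW hm)) (ltn_eqF hm) mul0r.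
pose c k := s * b k + (1 - s) * q k.
have cb m : (m < p)%N -> sym_moment p c m = sym_moment p b m.
  by move=> hm; rewrite sym_moment_blend qb //; ring.
have c0 : sym_moment p c 0 = 1.
  rewrite cb // (mass_moment0 _ (@int01 R)) /int01.
  have := int01_deriv ('X : {poly R}); rewrite derivX !hornerX subr0; exact.
have ac m : (m <= p)%N -> sym_moment p a m.+1 + sym_moment p c m = 0.
  rewrite leq_eqVlt => /predU1P[->|hm]; last by rewrite cb // stiff_mass_moment.
  (* for m = p this is the equation that defines tau *)
  rewrite sym_moment_blend /s tauE ?ltr01 //.
  move: (sym_moment p q p) (sym_moment p b p) (sym_moment p a p.+1) D0 => x y z
    D0.
  by field.
have [K hK] := eigenvalue_expansion mu (stiff_moment0 p (@int01 R)) c0 ac.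
apply/eqaddOP; near=> k.
have kK : K <= k by near: k; apply: nbhs_pinfty_ge; exact: num_real.
apply: filterS2 hK (nbhs_right_gt 0) => h hh h0.
have tau_s : tau (quad Q) h p j = s by rewrite /s !tauE.
have h4 : 0 <= h ^+ (2 * p + 4) by rewrite exprn_ge0 // ltW.
rewrite [`|h ^+ _|]ger0_norm //; apply: le_trans (ler_wpM2r h4 kK).
apply: le_trans hh; rewrite le_eqVlt; apply/orP; left; apply/eqP; congr (`|_|).
have blend_mass k' : mass_quad (blend s (quad G) (quad Q)) h p j k'%:Z = c k'.
  by rewrite mass_quadE // /c /b -G_mass.
rewrite !fctE tau_s; congr (_ - _ - _).
  rewrite /approx_eigenvalue /symbol; congr (_ * (_ / _)).
    rewrite stiffnessE //; congr (_ + 2 * _); apply: eq_bigr => l _.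
    by rewrite stiffnessE // mulrA.
  rewrite (blend_mass 0%N); congr (_ + 2 * _); apply: eq_bigr => l _.
  by rewrite blend_mass mulrA.
congr (_ * _ * _); rewrite !sym_momentS -mulrDr mulrCA mulrA; congr (_ * _).
rewrite -big_split /=; apply: eq_bigr => l _.
have -> : (2 * p.+1 + 2 = 2 * p + 4)%N by lia.
by rewrite stiffnessE // massE // mass_quadE.
Unshelve. all: by end_near.
Qed.
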